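(* For all integers $n\geq 1$ and $d\geq 2$, the iterate map $\Phi_n:\mathrm{Rat}_d\to\mathrm{Rat}_{d^n}$ given by $f\mapsto f^n$ is proper.
   Context: $\mathrm{Rat}_d$ is the space of holomorphic maps $f:\mathbf{P}^1\to\mathbf{P}^1$ of degree $d$ (with $\mathbf{P}^1$ the complex projective line), with the topology of uniform convergence; equivalently, writing $f=(P:Q)$ with $P,Q$ homogeneous of degree $d$ without common factor, it is the open subset of $\mathbf{P}^{2d+1}$ (coefficients of $(P,Q)$ up to scale) where the resultant of $P,Q$ does not vanish. $f^n$ denotes the $n$-fold composition of $f$ with itself. A continuous map is proper if preimages of compact sets are compact. *)

(* Defs.v *)
From HB Require Import structures.
From mathcomp Require Import all_boot all_order all_algebra.
From mathcomp Require Import generic_quotient.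
From mathcomp Require Import complex.
From mathcomp Require Import all_classical all_reals all_analysis.
From mathcomp Require Import ring lra.

Set Implicit Arguments.
Unset Strict Implicit.
Unset Printing Implicit Defensive.

Import Order.TTheory GRing.Theory Num.Theory.
Import ComplexField.Normc.

Local Open Scope quotient_scope.
Local Open Scope classical_set_scope.
Local Open Scope ring_scope.

(* A proper map is in particular continuous. *)
Definition proper_map (X Y : topologicalType) (f : X -> Y) : Prop :=
  continuous f /\ (forall K : set Y, compact K -> compact (f @^-1` K)).

Section ProjectiveLine.
Variable R : realType.
Local Notation C := R[i].

Definition cvec := {v : C * C | v != 0}.

Definition proportional (u v : cvec) : bool :=
  `[< exists2 c : C, c != 0 & val v = (c * (val u).1, c * (val u).2) >].

Lemma proportional_refl : reflexive proportional.
Proof.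
move=> u; apply/asboolP; exists 1; first exact: oner_neq0.
by rewrite !mul1r; case: (val u).
Qed.

Lemma proportional_sym : symmetric proportional.
Proof.
suff H u v : proportional u v -> proportional v u.
  by move=> u v; apply/idP/idP; exact: H.
move=> /asboolP[c c0 e]; apply/asboolP; exists c^-1; first by rewrite invr_eq0.
by rewrite e /= !mulKf //; case: (val u).
Qed.

Lemma proportional_trans : transitive proportional.
Proof.
move=> v u w /asboolP[a a0 ea] /asboolP[b b0 eb]; apply/asboolP.
exists (b * a); first by rewrite mulf_neq0.
by rewrite eb ea /= !mulrA.
Qed.

Canonical proportional_equiv :=
  EquivRel proportional proportional_refl proportional_sym proportional_trans.

Definition P1 := {eq_quot proportional}.

HB.instance Definition _ := Choice.on P1.

Lemma e1_neq0 : ((1, 0) : C * C) != 0.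
Proof. by apply/eqP => -[] /eqP; rewrite oner_eq0. Qed.

(* The point with homogeneous coordinates v; (0, 0), which has no meaning, is
   sent to the arbitrary point (1 : 0). *)
Definition toP1 (v : C * C) : P1 := \pi_P1 (insubd (Sub (1, 0) e1_neq0) v).

Definition hnorm (u : C * C) : R :=
  Num.sqrt (normc u.1 ^+ 2 + normc u.2 ^+ 2).

(* The sine of the angle between the lines spanned by u and v, i.e. half the
   chordal distance on the Riemann sphere of diameter 2. *)
Definition chordal (u v : C * C) : R :=
  normc (u.1 * v.2 - u.2 * v.1) / (hnorm u * hnorm v).

Lemma normc2E (z : C) : normc z ^+ 2 = complex.Re z ^+ 2 + complex.Im z ^+ 2.
Proof. by case: z => a b /=; rewrite sqr_sqrtr // addr_ge0 ?sqr_ge0. Qed.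

Lemma normc_ge0 (z : C) : 0 <= normc z.
Proof. by case: z => a b /=; exact: sqrtr_ge0. Qed.

Lemma hnorm_ge0 u : 0 <= hnorm u. Proof. exact: sqrtr_ge0. Qed.

Lemma hnorm2E u : hnorm u ^+ 2 = normc u.1 ^+ 2 + normc u.2 ^+ 2.
Proof. by rewrite sqr_sqrtr // addr_ge0 ?sqr_ge0. Qed.

Lemma hnorm_gt0 u : u != 0 -> 0 < hnorm u.
Proof.
move=> u0; rewrite lt_neqAle hnorm_ge0 andbT eq_sym; apply: contra u0 => /eqP h.
have := hnorm2E u; rewrite h expr0n /= => /esym/eqP.
rewrite paddr_eq0 ?sqr_ge0 // !sqrf_eq0 => /andP[/eqP h1 /eqP h2].
by case: u h h1 h2 => a b _ /= /eq0_normc -> /eq0_normc ->.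
Qed.

Lemma hnormZ (c : C) (u : C * C) : hnorm (c * u.1, c * u.2) = normc c * hnorm u.
Proof.
rewrite /hnorm /= !normcM !exprMn -mulrDr sqrtrM ?sqr_ge0 //.
by rewrite sqrtr_sqr ger0_norm ?normc_ge0.
Qed.

Lemma chordal_sym u v : chordal u v = chordal v u.
Proof.
rewrite /chordal [hnorm u * _]mulrC; congr (_ / _).
by rewrite -(normcN (_ - _)); congr normc; ring.
Qed.

Lemma chordalZ (c : C) (u v : C * C) : c != 0 -> chordal (c * u.1, c * u.2) v = chordal u v.
Proof.
move=> c0; rewrite /chordal hnormZ /=.
have -> : c * u.1 * v.2 - c * u.2 * v.1 = c * (u.1 * v.2 - u.2 * v.1) by ring.
have n0 : normc c != 0 by apply: contra c0 => /eqP /eq0_normc ->.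
by rewrite normcM -[normc c * hnorm u * _]mulrA -mulf_div divff // mul1r.
Qed.

Lemma chordal_triangle (u v w : C * C) : u != 0 -> v != 0 -> w != 0 ->
  chordal u w <= chordal u v + chordal v w.
Proof.
move=> u0 v0 w0.
have [Nu Nv Nw] := And3 (hnorm_gt0 u0) (hnorm_gt0 v0) (hnorm_gt0 w0).
pose h (x y : C * C) : C := x.1 * conjc y.1 + x.2 * conjc y.2.
pose D (x y : C * C) : C := x.1 * y.2 - x.2 * y.1.
have CS x y : normc (h x y) <= hnorm x * hnorm y.
  rewrite -ler_sqr ?nnegrE ?normc_ge0 ?mulr_ge0 ?hnorm_ge0 //.
  rewrite exprMn !hnorm2E.
  suff -> : (normc x.1 ^+ 2 + normc x.2 ^+ 2) * (normc y.1 ^+ 2 + normc y.2 ^+ 2)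
     = normc (h x y) ^+ 2 + normc (D x y) ^+ 2 by rewrite lerDl sqr_ge0.
  rewrite !normc2E /h /D.
  by case: x y => [[a b] [c d]] [[a' b'] [c' d']] /=; simpc => /=; ring.
have hvv : normc (h v v) = hnorm v ^+ 2.
  have -> : h v v = (hnorm v ^+ 2)%:C%C.
    rewrite hnorm2E !normc2E /h; case: (v) => [[a b] [c d]] /=; simpc.
    by congr (_ +i* _)%C; ring.
  by rewrite /= expr0n /= addr0 sqrtr_sqr ger0_norm // sqr_ge0.
have key : normc (D u w) * hnorm v ^+ 2 <=
    normc (D u v) * (hnorm w * hnorm v) + normc (D v w) * (hnorm u * hnorm v).
  rewrite -hvv -normcM.
  have -> : D u w * h v v = D u v * h w v + D v w * h u v by rewrite /D /h; ring.
  apply: le_trans (le_normcD _ _) _.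
  by rewrite !normcM lerD // ler_wpM2l ?normc_ge0.
rewrite /chordal -/(D u w) -/(D u v) -/(D v w).
rewrite -(ler_pM2r (mulr_gt0 (mulr_gt0 Nu Nw) (exprn_gt0 2 Nv))).
have [nu nv nw] := And3 (lt0r_neq0 Nu) (lt0r_neq0 Nv) (lt0r_neq0 Nw).
apply: le_trans (le_trans _ key) _; rewrite le_eqVlt; apply/orP; left; apply/eqP.
  by field; rewrite nu nw.
by field; rewrite nu nv nw.
Qed.

Definition distP1 (x y : P1) : R := chordal (val (repr x)) (val (repr y)).

Lemma distP1_pi (u v : cvec) :
  distP1 (\pi_P1 u) (\pi_P1 v) = chordal (val u) (val v).
Proof.
rewrite /distP1.
have E (w : cvec) : exists2 c, c != 0 &
    val (repr (\pi_P1 w)) = (c * (val w).1, c * (val w).2).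
  suff /eqmodP/asboolP : w = repr (\pi_P1 w) %[mod P1] by [].
  by rewrite reprK.
have [a a0 ->] := E u; have [b b0 ->] := E v.
by rewrite chordalZ // chordal_sym chordalZ // chordal_sym.
Qed.

Lemma distP1xx x : distP1 x x = 0.
Proof.
by rewrite /distP1 /chordal [X in _ - X]mulrC subrr normc0 mul0r.
Qed.

Lemma distP1_eq0 x y : distP1 x y = 0 -> x = y.
Proof.
rewrite -[x]reprK -[y]reprK distP1_pi /chordal.
move: (repr x) (repr y) => {x y} [u u0] [v v0] /=.
have Nu := hnorm_gt0 u0; have Nv := hnorm_gt0 v0.
move=> /eqP; rewrite mulf_eq0 invr_eq0 (gt_eqF (mulr_gt0 Nu Nv)) orbF => /eqP.
move=> /eq0_normc /eqP; rewrite subr_eq0 => /eqP D0.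
apply/eqmodP/asboolP => /=.
case: u v u0 v0 D0 {Nu Nv} => [a b] [a' b'] /= u0 v0 D0.
have [a0|a0] := eqVneq a 0.
  have b0 : b != 0 by apply: contra u0 => /eqP ->; rewrite a0.
  have a'0 : a' = 0.
    by apply/eqP; move/eqP: D0; rewrite a0 mul0r eq_sym mulf_eq0 (negPf b0).
  exists (b' / b); last by rewrite a0 a'0 mulr0 divfK.
  by rewrite mulf_neq0 ?invr_eq0 //; apply: contra v0 => /eqP ->; rewrite a'0.
have Eb : b' = a' / a * b.
  by rewrite mulrAC [a' * b]mulrC -D0 mulrAC divff // mul1r.
exists (a' / a); last by rewrite divfK // -Eb.
rewrite mulf_neq0 ?invr_eq0 //; apply: contra v0 => /eqP a'0.
by rewrite Eb a'0 !mul0r.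
Qed.

Lemma distP1_sym x y : distP1 x y = distP1 y x.
Proof. exact: chordal_sym. Qed.

Lemma distP1_triangle y x z : distP1 x z <= distP1 x y + distP1 y z.
Proof. exact: chordal_triangle (valP (repr x)) (valP (repr y)) (valP (repr z)). Qed.

HB.instance Definition _ :=
  isMetric.Build R P1 distP1xx distP1_eq0 distP1_sym distP1_triangle.

End ProjectiveLine.

Section RationalMaps.
Variable R : realType.
Local Notation C := R[i].
Local Notation P1 := (P1 R).

(* The value at v = (z, w) of the binary form w^d p(z/w) of degree d, for a
   polynomial p of degree at most d. *)
Definition hform (d : nat) (p : {poly C}) (v : C * C) : C :=
  \sum_(i < d.+1) p`_i * v.1 ^+ i * v.2 ^+ (d - i).

(* Holomorphic self-maps of P^1 of degree d, in the form (P : Q) with P, Q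
   binary forms of degree d without common factor.  Writing P = w^d p(z/w) and
   Q = w^d q(z/w), a common factor is either a common factor of p and q, or w;
   the latter divides both forms iff p and q both have degree < d (recall that
   size = degree + 1).  So d is the usual degree max (deg p, deg q) of p/q.
   The ambient space carries the topology of uniform convergence for the
   chordal metric of P^1. *)
Definition ratMap (d : nat) : set {uniform P1 -> P1} :=
  [set f | exists p q : {poly C},
    [/\ coprimep p q, maxn (size p) (size q) = d.+1 &
        forall v : cvec R,
          f (\pi_P1 v) = toP1 (hform d p (val v), hform d q (val v))]].

Lemma hform_fin d (p : {poly C}) (z w : C) : (size p <= d.+1)%N -> w != 0 ->
  hform d p (z, w) = w ^+ d * p.[z / w].
Proof.
move=> sp w0; rewrite /hform (horner_coef_wide _ sp) mulr_sumr.
apply: eq_bigr => i _ /=.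
have iled : (i <= d)%N by rewrite -ltnS.
have -> : w ^+ d = w ^+ (d - i) * w ^+ i by rewrite -exprD subnK.
rewrite expr_div_n.
have wi : w ^+ i != 0 by rewrite expf_neq0.
by field.
Qed.

Lemma hform_inf d (p : {poly C}) (z : C) : hform d p (z, 0) = p`_d * z ^+ d.
Proof.
rewrite /hform big_ord_recr /= subnn expr0 mulr1 big1 ?add0r // => i _.
by rewrite expr0n subn_eq0 leqNgt ltn_ord mulr0.
Qed.

(* The pairs (p, q) in ratMap are those whose forms have no common zero. *)
Lemma coprime_hformP d (p q : {poly C}) :
  coprimep p q /\ maxn (size p) (size q) = d.+1 <->
  [/\ (size p <= d.+1)%N, (size q <= d.+1)%N &
    forall v : C * C, v != 0 -> (hform d p v, hform d q v) != 0].
Proof.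
split=> [[cpq spq]|[sp sq nz]].
  have sp : (size p <= d.+1)%N by rewrite -spq leq_maxl.
  have sq : (size q <= d.+1)%N by rewrite -spq leq_maxr.
  split=> // -[z w] v0; apply/eqP => -[].
  have [w0|w0] := eqVneq w 0; last first.
    rewrite !hform_fin // => /eqP; rewrite mulf_eq0 expf_eq0 (negPf w0) andbF /=.
    move=> /eqP rp /eqP; rewrite mulf_eq0 expf_eq0 (negPf w0) andbF /=.
    by apply/negP; apply: coprimep_root cpq _; exact/rootP.
  have z0 : z != 0 by apply: contra v0 => /eqP ->; rewrite w0.
  rewrite w0 !hform_inf => /eqP; rewrite mulf_eq0 expf_eq0 (negPf z0) andbF orbF.
  move=> /eqP pd /eqP; rewrite mulf_eq0 expf_eq0 (negPf z0) andbF orbF => /eqP qd.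
  have lt (r : {poly C}) : (size r <= d.+1)%N -> r`_d = 0 -> (size r <= d)%N.
    move=> sr rd; rewrite leqNgt; apply/negP => lr.
    have e : size r = d.+1 by apply/eqP; rewrite eqn_leq sr.
    have : lead_coef r = 0 by rewrite lead_coefE e.
    by move/eqP; rewrite lead_coef_eq0 => /eqP r0; rewrite r0 size_poly0 in e.
  have : (maxn (size p) (size q) <= d)%N by rewrite geq_max !lt.
  by rewrite spq ltnn.
split.
  apply: Pdiv.ClosedField.root_coprimep => x /rootP px; apply/eqP => qx.
  have /nz/eqP : (x, 1) != 0 :> C * C by apply/eqP => -[_ /eqP]; rewrite oner_eq0.
  by apply; rewrite !hform_fin ?oner_eq0 // divr1 px qx !mulr0.
apply/eqP; rewrite eqn_leq geq_max sp sq /= leqNgt ltnS geq_max.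
apply/negP => /andP[lp lq]; have /eqP := nz _ (e1_neq0 R).
by apply; rewrite !hform_inf !nth_default // !mul0r.
Qed.

Lemma size_polyM_wide m n (p q : {poly C}) :
  (size p <= m.+1)%N -> (size q <= n.+1)%N -> (size (p * q)%R <= (m + n).+1)%N.
Proof.
move=> sp sq; apply: leq_trans (size_polyMleq _ _) _.
rewrite -subn1 leq_subLR add1n; apply: leq_trans (leq_add sp sq) _.
by rewrite addSn addnS.
Qed.

Lemma hformM m n (p q : {poly C}) v :
  (size p <= m.+1)%N -> (size q <= n.+1)%N ->
  hform (m + n) (p * q) v = hform m p v * hform n q v.
Proof.
move=> sp sq; case: v => z w.
have spq := size_polyM_wide sp sq.
have [->|w0] := eqVneq w 0; last by rewrite !hform_fin // hornerM exprD; ring.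
rewrite !hform_inf exprD coefM.
have lm : (m < (m + n).+1)%N by rewrite ltnS leq_addr.
rewrite (bigD1 (Ordinal lm)) //= addKn big1 ?addr0; first by ring.
move=> i; rewrite -val_eqE /= => im; have [lt|ge] := ltnP i m.
  rewrite [q`__]nth_default ?mulr0 //; apply: leq_trans sq _.
  by rewrite ltn_subRL ltn_add2r.
rewrite nth_default ?mul0r //; apply: leq_trans sp _.
by rewrite ltn_neqAle eq_sym im.
Qed.

Lemma hformX m k (p : {poly C}) v : (size p <= m.+1)%N ->
  (size (p ^+ k) <= (m * k).+1)%N /\ hform (m * k) (p ^+ k) v = hform m p v ^+ k.
Proof.
move=> sp; elim: k => [|k [sk IH]].
  rewrite muln0 !expr0 size_poly1; split=> //.
  by rewrite /hform big_ord1 coefC /= !expr0 !mulr1.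
rewrite mulnS !exprS hformM // IH; split=> //.
exact: size_polyM_wide.
Qed.

Lemma hform_sum n (I : Type) (r : seq I) (F : I -> {poly C}) v :
  hform n (\sum_(i <- r) F i) v = \sum_(i <- r) hform n (F i) v.
Proof.
rewrite /hform exchange_big /=; apply: eq_bigr => i _.
by rewrite coef_sum !mulr_suml.
Qed.

Lemma hformZ n c (p : {poly C}) v : hform n (c *: p) v = c * hform n p v.
Proof.
by rewrite /hform mulr_sumr; apply: eq_bigr => i _; rewrite coefZ !mulrA.
Qed.

(* The polynomial of the binary form P(A, B), of degree d * e. *)
Definition subst_form (d : nat) (p a b : {poly C}) : {poly C} :=
  \sum_(i < d.+1) p`_i *: (a ^+ i * b ^+ (d - i)).

Lemma subst_formP d e (p a b : {poly C}) v :
  (size a <= e.+1)%N -> (size b <= e.+1)%N ->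
  (size (subst_form d p a b) <= (d * e).+1)%N /\
  hform (d * e) (subst_form d p a b) v = hform d p (hform e a v, hform e b v).
Proof.
move=> sa sb.
have E (i : 'I_d.+1) : (d * e = e * i + e * (d - i))%N.
  by rewrite -mulnDr subnKC 1?mulnC // -ltnS.
split.
  apply: leq_trans (size_sum _ _ _) _; apply/bigmax_leqP => i _.
  apply: leq_trans (size_scale_leq _ _) _.
  have [s1 _] := hformX i v sa; have [s2 _] := hformX (d - i) v sb.
  by rewrite {1}(E i); exact: size_polyM_wide.
rewrite /subst_form hform_sum [RHS]/hform; apply: eq_bigr => i _ /=.
have [s1 e1] := hformX i v sa; have [s2 e2] := hformX (d - i) v sb.
by rewrite hformZ (E i) hformM // e1 e2 mulrA.
Qed.

Lemma comp_ratMap d e (f g : {uniform P1 -> P1}) :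
  ratMap d f -> ratMap e g -> ratMap (d * e)%N (f \o g).
Proof.
move=> [p [q [cpq spq fE]]] [a [b [cab sab gE]]].
have [sp sq nzpq] := (coprime_hformP d p q).1 (conj cpq spq).
have [sa sb nzab] := (coprime_hformP e a b).1 (conj cab sab).
exists (subst_form d p a b), (subst_form d q a b).
have S r v := @subst_formP d e r a b v sa sb.
have [] : coprimep (subst_form d p a b) (subst_form d q a b) /\
    maxn (size (subst_form d p a b)) (size (subst_form d q a b)) = (d * e).+1.
  apply/coprime_hformP; split; [exact: (S p 0).1|exact: (S q 0).1|] => v v0.
  by rewrite !(S _ v).2; exact: nzpq _ (nzab v v0).
split=> // v; rewrite /= gE !(S _ _).2.
by rewrite /toP1 fE val_insubd (nzab _ (valP v)).
Qed.

Lemma id_ratMap : ratMap 1 (id : {uniform P1 -> P1}).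
Proof.
exists 'X, 1; split; first exact: coprimep1.
  by rewrite size_polyX size_poly1.
case=> -[z w] v0 /=; rewrite /hform !big_ord_recl !big_ord0 /=.
rewrite !coefX !coef1 /= !(mul0r, mul1r, add0r, addr0, expr0, expr1, mulr1).
by congr \pi; apply: val_inj; rewrite val_insubd v0.
Qed.

Lemma iter_ratMap n d (f : {uniform P1 -> P1}) :
  ratMap d f -> ratMap (d ^ n)%N (iter n f).
Proof.
move=> df; elim: n => [|n IH]; first exact: id_ratMap.
rewrite expnS; exact: (comp_ratMap df IH).
Qed.

(* The sets ratMap d and ratMap (d ^ n) are coerced to types, which carry the
   subspace topology. *)
Definition iterate_map (n d : nat) (f : ratMap d) : ratMap (d ^ n)%N :=
  SigSub (mem_set (iter_ratMap n (set_valP f))).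

End RationalMaps.

(* Main.v *)
Require Import Defs.
From mathcomp Require Import all_boot all_order all_algebra.
From mathcomp Require Import generic_quotient complex.
From mathcomp Require Import all_classical all_reals all_analysis.
From mathcomp Require Import ring lra.

(** Write F : C^2 -> C^2 for a homogeneous lift of a rational map f of degree d
    and consider the ratio r(v) = |F v| / |v|^d, which is positive and depends
    only on the line of v.  Call the supremum of r(u) / r(v) the distortion of
    f.  It does not depend on the lift, and it measures how far f is from the
    boundary of the space of rational maps: bounded distortion means that the
    lift, once normalized, has bounded coefficients and no almost common zero.

    The heart of the matter is that the distortion of f is controlled by that
    of an iterate g = f^n, whose degree N = d^n is at least 2.  Let G = F^n, let
    rho(v) = |G v| / |v|^N and suppose rho(u) <= k rho(v) for all u, v.  Computing
    the norm of F (G v) = G (F v) in two ways gives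
        rho(F v) r(v)^N = r(G v) rho(v)^d.
    Dividing this identity at u by the same identity at v, every ratio
    s = r(u) / r(v) satisfies s^N <= k^(d+1) K, where K is the supremum of all
    these ratios; hence K^2 <= K^N <= k^(d+1) K, and so K <= k^(d+1)
    ([distortion_commute], [distorted_iter]).

    Two compactness statements turn this estimate into properness.

    - The distortion is locally bounded, hence bounded on compact sets
      ([distorted_near], [compact_distorted]).  If g is uniformly close to f,
      with lifts F = (P, Q) and (A, B), then the form P B - Q A is small
      compared with the lifts.  The linear map (A, B) |-> P B - Q A has for
      kernel the multiples of (P, Q), because P and Q are coprime; so (A, B) is
      close to a multiple of (P, Q), and its distortion is close to that of F.

    - A filter on the maps of distortion at most c clusters at a rational map
      of the same degree ([distorted_cluster]): normalized lifts have bounded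
      coefficients, and a cluster point of the coefficients inherits the lower
      bound on |F v|, so its two forms have no common zero.

    Given a compact set K of maps of degree d^n, its preimage thus consists of
    maps of bounded distortion, and it is closed because K is closed and
    iteration is continuous, rational maps being Lipschitz for the chordal
    metric ([ratMap_lipschitz]). *)

Set Implicit Arguments.
Unset Strict Implicit.
Unset Printing Implicit Defensive.

Import Order.TTheory GRing.Theory Num.Theory.
Import numFieldNormedType.Exports.
Import ComplexField.Normc.

Local Open Scope quotient_scope.
Local Open Scope classical_set_scope.
Local Open Scope ring_scope.

(** * Hermitian norm and wedge product on C^2 *)

Section Norms.
Variable R : realType.
Local Notation C := R[i].
Implicit Types (u v w : C * C) (x y z : C).

Definition wedge u v : C := u.1 * v.2 - u.2 * v.1.

Lemma normc_sum (I : Type) (r : seq I) (P : pred I) (F : I -> C) :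
  normc (\sum_(i <- r | P i) F i) <= \sum_(i <- r | P i) normc (F i).
Proof.
elim/big_ind2 : _ => [|x a y b xa yb|//]; first by rewrite normc0.
exact: le_trans (le_normcD a b) (lerD xa yb).
Qed.

Lemma normcX x k : normc (x ^+ k) = normc x ^+ k.
Proof. by elim: k => [|k IH]; rewrite ?expr0 ?normc1 // !exprS normcM IH. Qed.

Lemma normcB x y : normc (x - y) <= normc x + normc y.
Proof. by rewrite -(normcN y); exact: le_normcD. Qed.

Lemma normc_eq0 x : (normc x == 0) = (x == 0).
Proof. by apply/eqP/eqP => [/eq0_normc//|->]; rewrite normc0. Qed.

Lemma normc_gt0 x : (0 < normc x) = (x != 0).
Proof. by rewrite lt_neqAle normc_ge0 andbT eq_sym normc_eq0. Qed.

Lemma hnorm_le (T : C * C) (b : R) : 0 <= b ->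
  normc T.1 ^+ 2 + normc T.2 ^+ 2 <= b ^+ 2 -> hnorm T <= b.
Proof.
by move=> b0 h; rewrite -ler_sqr ?nnegrE ?hnorm_ge0 // hnorm2E.
Qed.

Lemma normc_fst_le u : normc u.1 <= hnorm u.
Proof.
by rewrite -ler_sqr ?nnegrE ?normc_ge0 ?hnorm_ge0 // hnorm2E lerDl sqr_ge0.
Qed.

Lemma normc_snd_le u : normc u.2 <= hnorm u.
Proof.
by rewrite -ler_sqr ?nnegrE ?normc_ge0 ?hnorm_ge0 // hnorm2E lerDr sqr_ge0.
Qed.

Lemma hnorm_le_add u : hnorm u <= normc u.1 + normc u.2.
Proof.
apply: hnorm_le; first by rewrite addr_ge0 ?normc_ge0.
have := normc_ge0 u.1; have := normc_ge0 u.2; nra.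
Qed.

Lemma cauchy_schwarz (a b c e A B : R) : 0 <= A -> 0 <= B ->
  A ^+ 2 = a ^+ 2 + b ^+ 2 -> B ^+ 2 = c ^+ 2 + e ^+ 2 -> a * c + b * e <= A * B.
Proof.
move=> A0 B0 hA hB; apply: le_trans (ler_norm _) _.
rewrite -ler_sqr ?nnegrE ?mulr_ge0 // real_normK ?num_real //.
rewrite exprMn hA hB -subr_ge0.
have -> : (a ^+ 2 + b ^+ 2) * (c ^+ 2 + e ^+ 2) - (a * c + b * e) ^+ 2 =
  (a * e - b * c) ^+ 2 by ring.
exact: sqr_ge0.
Qed.

Lemma hnorm_add u v : hnorm (u + v) <= hnorm u + hnorm v.
Proof.
apply: hnorm_le; first by rewrite addr_ge0 ?hnorm_ge0.
have h1 : normc (u + v).1 <= normc u.1 + normc v.1 by exact: le_normcD.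
have h2 : normc (u + v).2 <= normc u.2 + normc v.2 by exact: le_normcD.
have CS := cauchy_schwarz (hnorm_ge0 u) (hnorm_ge0 v) (hnorm2E u) (hnorm2E v).
have k1 : normc (u + v).1 ^+ 2 <= (normc u.1 + normc v.1) ^+ 2.
  by rewrite ler_sqr ?nnegrE ?addr_ge0 ?normc_ge0.
have k2 : normc (u + v).2 ^+ 2 <= (normc u.2 + normc v.2) ^+ 2.
  by rewrite ler_sqr ?nnegrE ?addr_ge0 ?normc_ge0.
apply: le_trans (lerD k1 k2) _; rewrite !sqrrD (hnorm2E u) (hnorm2E v); lra.
Qed.

Lemma wedge_le u v : normc (wedge u v) <= hnorm u * hnorm v.
Proof.
apply: le_trans (normcB _ _) _; rewrite !normcM.
apply: cauchy_schwarz; rewrite ?hnorm_ge0 ?hnorm2E //.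
by rewrite addrC.
Qed.

Lemma wedgeB u v w : wedge u (v - w) = wedge u v - wedge u w.
Proof. by rewrite /wedge /=; ring. Qed.

Lemma wedgexx u : wedge u u = 0.
Proof. by rewrite /wedge; ring. Qed.

Lemma toP1E v (v0 : v != 0) : toP1 v = \pi_(P1 R) (Sub v v0 : cvec R).
Proof. by congr \pi; apply: val_inj; rewrite val_insubd v0. Qed.

Lemma dist_toP1 u v : u != 0 -> v != 0 ->
  distP1 (toP1 u) (toP1 v) = normc (wedge u v) / (hnorm u * hnorm v).
Proof. by move=> u0 v0; rewrite !toP1E distP1_pi. Qed.

Lemma toP1Z x v : x != 0 -> v != 0 -> toP1 (x * v.1, x * v.2) = toP1 v.
Proof.
move=> x0 v0; have xv0 : (x * v.1, x * v.2) != 0 :> C * C.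
  apply: contra v0 => /eqP -[/eqP]; rewrite mulf_eq0 (negPf x0) /= => /eqP h1.
  move=> /eqP; rewrite mulf_eq0 (negPf x0) /= => /eqP h2.
  by case: v h1 h2 => a b /= -> ->.
apply: distP1_eq0; rewrite dist_toP1 // (_ : wedge _ _ = 0) ?normc0 ?mul0r //.
by rewrite /wedge /=; ring.
Qed.

Lemma P1_rep (x : P1 R) : exists v : cvec R, x = \pi_(P1 R) v.
Proof. by exists (repr x); rewrite reprK. Qed.

End Norms.

(** * Homogeneous lifts and their bounds *)

Section Forms.
Variable R : realType.
Local Notation C := R[i].
Implicit Types (u v w : C * C) (x y z : C) (p q a b : {poly C}).

Definition hlift d p q v : C * C := (hform d p v, hform d q v).

(** By [coprime_hformP], these are the pairs of polynomials of degree at most [d]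
    whose forms have no common zero on the projective line. *)
Definition coprime_pair d p q :=
  coprimep p q /\ maxn (size p) (size q) = d.+1.

Definition coefsum d p : R := \sum_(i < d.+1) normc p`_i.

Lemma coefsum_ge0 d p : 0 <= coefsum d p.
Proof. by apply: sumr_ge0 => i _; exact: normc_ge0. Qed.

Lemma hform_le d p v : normc (hform d p v) <= coefsum d p * hnorm v ^+ d.
Proof.
apply: le_trans (normc_sum _ _ _) _; rewrite mulr_suml ler_sum // => i _.
rewrite !normcM !normcX -mulrA ler_wpM2l ?normc_ge0 //.
have -> : hnorm v ^+ d = hnorm v ^+ i * hnorm v ^+ (d - i).
  by rewrite -exprD subnKC // -ltnS.
by rewrite ler_pM ?exprn_ge0 ?normc_ge0 // lerXn2r ?nnegrE ?normc_ge0
  ?hnorm_ge0 ?normc_fst_le ?normc_snd_le.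
Qed.

Lemma hlift_le d p q v :
  hnorm (hlift d p q v) <= (coefsum d p + coefsum d q) * hnorm v ^+ d.
Proof.
by apply: le_trans (hnorm_le_add _) _; rewrite mulrDl lerD ?hform_le.
Qed.

Lemma hformB d p q v : hform d (p - q) v = hform d p v - hform d q v.
Proof.
rewrite /hform -sumrB; apply: eq_bigr => i _.
by rewrite coefB !mulrBl.
Qed.

Lemma hform_homog d p x v :
  hform d p (x * v.1, x * v.2) = x ^+ d * hform d p v.
Proof.
rewrite /hform mulr_sumr; apply: eq_bigr => i _ /=.
have -> : x ^+ d = x ^+ i * x ^+ (d - i) by rewrite -exprD subnKC // -ltnS.
by rewrite !exprMn; ring.
Qed.

Lemma hlift_homog d p q x v : hlift d p q (x * v.1, x * v.2) =
  (x ^+ d * (hlift d p q v).1, x ^+ d * (hlift d p q v).2).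
Proof. by rewrite /hlift !hform_homog. Qed.

Lemma hliftZ d x p q v : hlift d (x *: p) (x *: q) v =
  (x * (hlift d p q v).1, x * (hlift d p q v).2).
Proof. by rewrite /hlift !hformZ. Qed.

Lemma hliftB d p q a b v :
  hlift d (p - a) (q - b) v = hlift d p q v - hlift d a b v.
Proof. by rewrite /hlift !hformB. Qed.

(** Reversing the coefficients exchanges the two coordinates, that is, the
    points 0 and infinity of the projective line. *)
Lemma hform_rev d p v :
  hform d (\poly_(i < d.+1) p`_(d - i)) v = hform d p (v.2, v.1).
Proof.
rewrite /hform (reindex_inj rev_ord_inj) /=; apply: eq_bigr => i _.
rewrite coef_poly subSS ltnS leq_subr subKn 1?mulrAC //.
by rewrite -ltnS ltn_ord.
Qed.

Lemma horner_le_coefsum d p x : (size p <= d.+1)%N -> normc x <= 1 ->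
  normc p.[x] <= coefsum d p.
Proof.
move=> sp x1; rewrite (horner_coef_wide _ sp).
apply: le_trans (normc_sum _ _ _) _; apply: ler_sum => i _.
by rewrite normcM normcX ler_piMr ?normc_ge0 // exprn_ile1 ?normc_ge0.
Qed.

(** A Bezout identity [a p + b q = 1] bounds the pair [(p, q)] from below on the
    unit disc, where the quotient of the coordinates lies. *)
Lemma hlift_lower_half d p q : coprime_pair d p q ->
  exists2 c : R, 0 < c & forall v, v.2 != 0 -> normc v.1 <= normc v.2 ->
    c * normc v.2 ^+ d <= hnorm (hlift d p q v).
Proof.
move=> cpq; have [sp sq _] := (coprime_hformP d p q).1 cpq.
have /Bezout_eq1_coprimepP[[a b] /= ab1] := cpq.1.
pose A := coefsum (size a) a; pose B := coefsum (size b) b.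
have A0 : 0 <= A by exact: coefsum_ge0.
have B0 : 0 <= B by exact: coefsum_ge0.
have AB : 0 < A + B + 1 by rewrite ltr_wpDl ?addr_ge0.
exists (A + B + 1)^-1; first by rewrite invr_gt0.
case=> z w /= w0 zw; set t := z / w.
have t1 : normc t <= 1.
  by rewrite normcM normcV ler_pdivrMr ?mul1r // normc_gt0.
have E : hnorm (hlift d p q (z, w)) = normc w ^+ d * hnorm (p.[t], q.[t]).
  by rewrite /hlift !hform_fin // -normcX -(hnormZ _ (_, _)).
rewrite E mulrC ler_wpM2l ?exprn_ge0 ?normc_ge0 //.
rewrite -div1r ler_pdivrMr //.
have : normc (a.[t] * p.[t] + b.[t] * q.[t]) = 1.
  by rewrite -!hornerM -hornerD ab1 hornerC normc1.
set S := hnorm _ => E1; rewrite -{1}E1.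
apply: le_trans (le_normcD _ _) _; rewrite !normcM.
have S0 : 0 <= S by exact: hnorm_ge0.
have h1 : normc a.[t] * normc p.[t] <= A * S.
  by rewrite ler_pM ?normc_ge0 ?horner_le_coefsum // (normc_fst_le (_, _)).
have h2 : normc b.[t] * normc q.[t] <= B * S.
  by rewrite ler_pM ?normc_ge0 ?horner_le_coefsum // (normc_snd_le (_, _)).
by apply: le_trans (lerD h1 h2) _; rewrite -mulrDl mulrC ler_wpM2l // lerDl.
Qed.

Lemma coprime_pair_rev d p q : coprime_pair d p q ->
  coprime_pair d (\poly_(i < d.+1) p`_(d - i)) (\poly_(i < d.+1) q`_(d - i)).
Proof.
move=> /coprime_hformP[sp sq nz]; apply/coprime_hformP.
split; [exact: size_poly|exact: size_poly|case=> z w v0].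
rewrite !hform_rev; apply: nz.
by apply: contra v0 => /eqP -[-> ->].
Qed.

(** The two half bounds, near 0 and near infinity, cover the whole sphere; this
    takes the place of a compactness argument. *)
Lemma hlift_lower d p q : coprime_pair d p q ->
  exists2 c : R, 0 < c & forall v, v != 0 ->
    c * hnorm v ^+ d <= hnorm (hlift d p q v).
Proof.
move=> cpq.
have [a a0 ha] := hlift_lower_half cpq.
have [b b0 hb] := hlift_lower_half (coprime_pair_rev cpq).
pose c := Num.min a b; have c0 : 0 < c by rewrite lt_min a0.
have P2 : 0 < (2 ^+ d : R) by rewrite exprn_gt0.
exists (c / 2 ^+ d); first by rewrite divr_gt0.
(* the norm of v is at most twice its larger coordinate *)
have H (s m r : R) v : c <= s -> 0 <= m -> s * m ^+ d <= r ->
    hnorm v <= 2 * m -> c / 2 ^+ d * hnorm v ^+ d <= r.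
  move=> cs m0 smr vm; apply: le_trans smr.
  rewrite mulrAC ler_pdivrMr // -mulrA -exprMn ler_pM ?(ltW c0) //.
    by rewrite exprn_ge0 ?hnorm_ge0.
  by rewrite lerXn2r ?nnegrE ?hnorm_ge0 ?mulr_ge0 // [m * 2]mulrC.
case=> z w v0; have := hnorm_le_add (z, w) => /= hv.
have [zw|wz] := leP (normc z) (normc w).
  have w0 : w != 0.
    apply: contra v0 => /eqP w0; move: zw; rewrite w0 normc0 => z0.
    by have /eqP := le_anti (introT andP (conj z0 (normc_ge0 z)));
      rewrite normc_eq0 => /eqP ->.
  apply: (H a (normc w)); rewrite ?ge_min ?lexx ?normc_ge0 //; last by lra.
  exact: ha (z, w) w0 zw.
have z0 : z != 0.
  by rewrite -normc_gt0; apply: le_lt_trans wz; exact: normc_ge0.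
apply: (H b (normc z)); rewrite ?ge_min ?lexx ?orbT ?normc_ge0 //; last by lra.
apply: le_trans (hb (w, z) z0 (ltW wz)) _.
by rewrite /hlift !hform_rev.
Qed.

Lemma hlift_neq0 d p q v : coprime_pair d p q -> v != 0 -> hlift d p q v != 0.
Proof. by move=> /coprime_hformP[_ _]; exact. Qed.

(** The dehomogenization of the form [wedge (hlift d p q v) (hlift d a b v)]; it
    vanishes iff the two lifts define the same map where both are nonzero. *)
Definition wedge_poly p q a b : {poly C} := p * b - q * a.

Lemma wedge_hliftE d p q a b x : (size p <= d.+1)%N -> (size q <= d.+1)%N ->
  (size a <= d.+1)%N -> (size b <= d.+1)%N ->
  wedge (hlift d p q (x, 1)) (hlift d a b (x, 1)) = (wedge_poly p q a b).[x].
Proof.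
move=> sp sq sa sb; rewrite /wedge /hlift /= !hform_fin ?oner_eq0 //.
by rewrite !expr1n !mul1r divr1 !hornerE.
Qed.

Lemma size_wedge_poly d p q a b : (size p <= d.+1)%N -> (size q <= d.+1)%N ->
  (size a <= d.+1)%N -> (size b <= d.+1)%N ->
  (size (wedge_poly p q a b) <= (d + d).+1)%N.
Proof.
move=> sp sq sa sb; apply: leq_trans (size_polyD _ _) _.
by rewrite size_polyN geq_max !size_polyM_wide.
Qed.

Lemma poly_zero_nat m p : (size p <= m)%N ->
  (forall j, (j < m)%N -> p.[j%:R] = 0) -> p = 0.
Proof.
move=> sp h; apply/eqP; apply: contraT => p0.
have inj : injective (fun j : nat => j%:R : C) by exact: mulrIn (oner_neq0 _).
have := @max_poly_roots _ p [seq j%:R : C | j <- iota 0 m] p0.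
rewrite size_map size_iota map_inj_uniq // iota_uniq => /(_ _ isT) lt.
have := leq_trans (lt _) sp; rewrite ltnn; apply.
apply/allP => x /mapP[j]; rewrite mem_iota /= => jm ->.
by apply/rootP; exact: h.
Qed.

Lemma proportional_pairs_half d p q a b : coprimep p q -> size p = d.+1 ->
  (size a <= d.+1)%N -> p * b = q * a -> exists x, a = x *: p /\ b = x *: q.
Proof.
move=> cpq sp sa E.
have p0 : p != 0 by rewrite -size_poly_gt0 sp.
have /dvdpP[r ar] : p %| a by rewrite -(Gauss_dvdpr _ cpq) -E dvdp_mulr.
have sr : (size r <= 1)%N.
  have [->|r0] := eqVneq r 0; first by rewrite size_poly0.
  by move: sa; rewrite ar size_mul // sp addnS /= -add1n leq_add2r.
exists r`_0; rewrite -!mul_polyC -(size1_polyC sr); split=> //.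
by apply: (mulfI p0); rewrite E ar; ring.
Qed.

(** A coprime lift is determined, up to a scalar, by the map that it defines:
    [p b = q a] makes [p] divide [a] and [q] divide [b], and the one of [p] and
    [q] with the maximal size leaves no room for a nonconstant quotient. *)
Lemma proportional_pairs d p q a b : coprime_pair d p q ->
  (size a <= d.+1)%N -> (size b <= d.+1)%N -> wedge_poly p q a b = 0 ->
  exists x, a = x *: p /\ b = x *: q.
Proof.
move=> [cpq mx] sa sb /eqP; rewrite subr_eq0 => /eqP E.
have [qp|pq] := leqP (size q) (size p).
  apply: proportional_pairs_half cpq _ sa E.
  by rewrite -mx; apply/esym/maxn_idPl.
rewrite coprimep_sym in cpq.
have sq : size q = d.+1 by rewrite -mx; apply/esym/maxn_idPr/ltnW.
by have [x [h1 h2]] := proportional_pairs_half cpq sq sb (esym E); exists x.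
Qed.

End Forms.

(** * Perturbation of lifts *)

Section Stability.
Variable R : realType.
Local Notation C := R[i].
Implicit Types (u v w : C * C) (x y z : C) (p q a b : {poly C}).

(** A linear map is bounded below modulo its kernel: the difference between [u]
    and its kernel component is recovered from [u *m A] by the partial inverse
    of [A], whose entries give the constant. *)
Lemma near_kernel m n (A : 'M[C]_(m, n)) : exists2 K : R, 0 <= K &
  forall u : 'rV_m, exists k : 'rV_m, k *m A = 0 /\
    forall e : R, 0 <= e -> (forall j, normc ((u *m A) 0 j) <= e) ->
    forall i, normc ((u - k) 0 i) <= K * e.
Proof.
exists (\sum_i \sum_j normc (pinvmx A j i)).
  by apply: sumr_ge0 => i _; apply: sumr_ge0 => j _; exact: normc_ge0.
move=> u; exists (u - u *m A *m pinvmx A); split.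
  by rewrite mulmxBl mulmxKpV ?subrr // submxMl.
move=> e e0 he i; rewrite opprB addrC subrK mxE.
apply: le_trans (normc_sum _ _ _) _.
rewrite (bigD1 i) //= mulrDl; apply: ler_wpDr.
  rewrite mulr_ge0 //; apply: sumr_ge0 => l _.
  by apply: sumr_ge0 => j _; exact: normc_ge0.
rewrite mulr_suml; apply: ler_sum => j _.
by rewrite normcM mulrC ler_wpM2l ?normc_ge0.
Qed.

Lemma mul_eval_mx d p m (c f : 'I_m -> C) (j : 'I_m) : (size p <= d.+1)%N ->
  ((poly_rV p : 'rV_d.+1) *m \matrix_(i, j) (c j * f j ^+ i)) 0 j =
  c j * p.[f j].
Proof.
move=> sp; rewrite mxE (horner_coef_wide _ sp) mulr_sumr.
by apply: eq_bigr => i _; rewrite !mxE; ring.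
Qed.

(** A polynomial of degree at most [d] is determined by its values at the points
    [0, ..., d], so [near_kernel] applies with a trivial kernel. *)
Lemma coefsum_le_values d : exists2 K : R, 0 <= K & forall p (e : R),
  (size p <= d.+1)%N -> 0 <= e ->
  (forall j, (j < d.+1)%N -> normc p.[j%:R] <= e) -> coefsum d p <= K * e.
Proof.
have [K K0 HK] :=
  near_kernel (\matrix_(i < d.+1, j < d.+1) (1 * (j%:R : C) ^+ i)).
exists (d.+1%:R * K); first by rewrite mulr_ge0.
move=> p e sp e0 he; have [k [kA hk]] := HK (poly_rV p).
have k0 : k = 0.
  rewrite -[k]rVpolyK (_ : rVpoly k = 0) ?linear0 //.
  apply: (@poly_zero_nat _ d.+1); first exact: size_poly.
  move=> j jd; have := mul_eval_mx (fun=> 1) (fun j : 'I_d.+1 => j%:R) (Ordinal jd)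
    (size_poly _ _ : (size (rVpoly k) <= d.+1)%N).
  by rewrite rVpolyK kA mxE mul1r.
have {}hk (i : 'I_d.+1) : normc p`_i <= K * e.
  have := hk e e0; rewrite k0 subr0 => /(_ _ i); rewrite mxE; apply=> j.
  by rewrite (mul_eval_mx (fun=> 1) (fun j : 'I_d.+1 => j%:R)) // mul1r he.
have -> : d.+1%:R * K * e = \sum_(i < d.+1) K * e.
  by rewrite sumr_const card_ord -mulrA mulr_natl.
by apply: ler_sum => i _; exact: hk.
Qed.

Lemma coefsum_subr d p a : coefsum d p <= coefsum d a + coefsum d (p - a).
Proof.
rewrite -big_split /=; apply: ler_sum => i _.
by apply: le_trans (le_normcD _ _); rewrite coefB addrC subrK.
Qed.

Lemma coefsumZ d x p : coefsum d (x *: p) = normc x * coefsum d p.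
Proof. by rewrite mulr_sumr; apply: eq_bigr => i _; rewrite coefZ normcM. Qed.

(** If the map defined by [(a, b)] is close to the one defined by [(p, q)], then
    [(a, b)] is close to a multiple of [(p, q)].  Indeed the linear map
    [(a, b) |-> p b - q a], evaluated at [2 d + 1] points, has the multiples of
    [(p, q)] as its kernel, so that [near_kernel] applies. *)
Lemma near_proportional d p q : coprime_pair d p q ->
  exists2 L : R, 0 <= L & forall a b (e : R),
    (size a <= d.+1)%N -> (size b <= d.+1)%N -> 0 <= e ->
    (forall v, v != 0 -> normc (wedge (hlift d p q v) (hlift d a b v)) <=
       e * (hnorm (hlift d p q v) * hnorm (hlift d a b v))) ->
    exists x, coefsum d (a - x *: p) + coefsum d (b - x *: q) <=
      L * e * (coefsum d a + coefsum d b).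
Proof.
move=> cpq; have [sp sq _] := (coprime_hformP d p q).1 cpq.
pose J := 'I_(d + d).+1.
(* a wedge polynomial has degree at most 2d, so that 2d + 1 points detect it *)
pose A : 'M[C]_(d.+1 + d.+1, (d + d).+1) := col_mx
  (\matrix_(i, j) (- q.[j%:R] * j%:R ^+ i))
  (\matrix_(i, j) (p.[j%:R] * j%:R ^+ i)).
have AE a b (j : J) : (size a <= d.+1)%N -> (size b <= d.+1)%N ->
    (row_mx (poly_rV a) (poly_rV b) *m A) 0 j = (wedge_poly p q a b).[j%:R].
  move=> sa sb; rewrite mul_row_col mxE.
  rewrite (mul_eval_mx (fun j : J => - q.[j%:R]) (fun j : J => j%:R)) //.
  rewrite (mul_eval_mx (fun j : J => p.[j%:R]) (fun j : J => j%:R)) //.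
  by rewrite !hornerE addrC mulNr.
have [K K0 HK] := near_kernel A.
pose S := coefsum d p + coefsum d q.
have S0 : 0 <= S by rewrite addr_ge0 ?coefsum_ge0.
pose B : R := \sum_(j < (d + d).+1) hnorm (j%:R, 1 : C).
have B0 : 0 <= B by apply: sumr_ge0 => j _; exact: hnorm_ge0.
have BE (j : J) : hnorm (j%:R, 1 : C) <= B.
  rewrite /B (bigD1 j) //= lerDl; apply: sumr_ge0 => i _; exact: hnorm_ge0.
pose M := S * B ^+ d * B ^+ d.
have M0 : 0 <= M by rewrite !mulr_ge0 ?exprn_ge0.
exists (2 * d.+1%:R * K * M); first by apply: mulr_ge0 M0; rewrite !mulr_ge0.
move=> a b e sa sb e0 he; pose T := coefsum d a + coefsum d b.
have T0 : 0 <= T by rewrite addr_ge0 ?coefsum_ge0.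
have [k [kA hk]] := HK (row_mx (poly_rV a) (poly_rV b)).
have [x [xp xq]] : exists x, rVpoly (lsubmx k) = x *: p /\ rVpoly (rsubmx k) = x *: q.
  apply: proportional_pairs cpq _ _ _; try exact: size_poly.
  apply: (@poly_zero_nat _ (d + d).+1).
    by apply: size_wedge_poly; rewrite ?size_poly.
  move=> j jd; rewrite -(AE _ _ (Ordinal jd)) ?size_poly // !rVpolyK hsubmxK.
  by rewrite kA mxE.
exists x.
have bound : forall i, normc ((row_mx (poly_rV a) (poly_rV b) - k) 0 i) <= K * (e * M * T).
  apply: hk; first by rewrite mulr_ge0 //; apply: mulr_ge0 M0.
  move=> j; rewrite AE // -(@wedge_hliftE _ d) //.
  have j0 : (j%:R, 1) != 0 :> C * C by apply/eqP => -[_ /eqP]; rewrite oner_eq0.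
  apply: le_trans (he _ j0) _; rewrite -(mulrA e M T) ler_wpM2l //.
  have -> : M * T = (S * B ^+ d) * (T * B ^+ d) by rewrite /M; ring.
  have h (r s : R) : 0 <= r -> s <= r * hnorm (j%:R, 1 : C) ^+ d -> s <= r * B ^+ d.
    move=> r0 h; apply: le_trans h _; rewrite ler_wpM2l // lerXn2r //.
    by rewrite nnegrE hnorm_ge0.
  by apply: ler_pM; rewrite ?hnorm_ge0 //; apply: h => //; exact: hlift_le.
rewrite -xp -xq.
have dl (i : 'I_d.+1) : normc (a - rVpoly (lsubmx k))`_i <= K * (e * M * T).
  have := bound (lshift _ i); rewrite mxE row_mxEl !mxE.
  by rewrite coefB coef_rVpoly_ord mxE.
have dr (i : 'I_d.+1) : normc (b - rVpoly (rsubmx k))`_i <= K * (e * M * T).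
  have := bound (rshift _ i); rewrite mxE row_mxEr !mxE.
  by rewrite coefB coef_rVpoly_ord mxE.
have -> : 2 * d.+1%:R * K * M * e * T =
   \sum_(i < d.+1) K * (e * M * T) + \sum_(i < d.+1) K * (e * M * T).
  by rewrite !sumr_const card_ord -[_ *+ _]mulr_natl; ring.
by apply: lerD; apply: ler_sum => i _.
Qed.

(** The inequality r(u) <= c r(v) for the ratio r(v) = |F v| / |v|^k, cleared of
    denominators. *)
Definition distortion k (c : R) (F : C * C -> C * C) := forall u v,
  u != 0 -> v != 0 -> hnorm (F u) * hnorm v ^+ k <= c * (hnorm (F v) * hnorm u ^+ k).

(** The distortion is stable under perturbation.  By [near_proportional] the
    perturbed lift is [x F + E], where [E] is at most half of the lower bound of
    [x F] as soon as the closeness [e] is small enough. *)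
Lemma distortion_near d p q : coprime_pair d p q -> exists e c : R, 0 < e /\
  forall a b, (size a <= d.+1)%N -> (size b <= d.+1)%N ->
    (forall v, v != 0 -> normc (wedge (hlift d p q v) (hlift d a b v)) <=
       e * (hnorm (hlift d p q v) * hnorm (hlift d a b v))) ->
    distortion d c (hlift d a b).
Proof.
move=> cpq; have [m m0 hm] := hlift_lower cpq.
have [L L0 HL] := near_proportional cpq.
pose S := coefsum d p + coefsum d q.
have S0 : 0 <= S by rewrite addr_ge0 ?coefsum_ge0.
(* this makes L e <= 1/2 and 2 L e S <= m / 2 *)
pose e := Num.min 1 m / (4 * (L + 1) * (S + 1)).
have D0 : 0 < 4 * (L + 1) * (S + 1) by rewrite !mulr_gt0 // ltr_wpDl.
have e0 : 0 < e by rewrite divr_gt0 // lt_min m0 ltr01.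
have eD : e * (4 * (L + 1) * (S + 1)) = Num.min 1 m.
  by rewrite /e divfK // gt_eqF.
have e1 : e * (4 * (L + 1) * (S + 1)) <= 1 by rewrite eD ge_min lexx.
have em : e * (4 * (L + 1) * (S + 1)) <= m by rewrite eD ge_min lexx orbT.
exists e, ((S + m / 2) / (m / 2)); split=> // a b sa sb he.
have [x hx] := HL a b e sa sb (ltW e0) he.
set T := coefsum d (a - _) + _ in hx; set U := coefsum d a + _ in hx.
have U0 : 0 <= U by rewrite addr_ge0 ?coefsum_ge0.
have UT : U <= normc x * S + T.
  rewrite mulrDr -!coefsumZ addrACA lerD //; exact: coefsum_subr.
have X0 := normc_ge0 x.
have Le : L * e <= 2^-1 by nra.
have U2 : U <= 2 * (normc x * S) by nra.
have Tm : T <= normc x * (m / 2).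
  apply: le_trans hx _; apply: le_trans (ler_wpM2l _ U2) _.
    by rewrite mulr_ge0 // ltW.
  have -> : L * e * (2 * (normc x * S)) = normc x * (2 * (L * S) * e) by ring.
  rewrite ler_wpM2l //.
  have h : 2 * (L * S) <= 2 * ((L + 1) * (S + 1)) by nra.
  apply: le_trans (ler_wpM2r (ltW e0) h) _; lra.
(* S and m bound the ratio |F v| / |v|^d of F = hlift d p q from above and below *)
have dv v : hnorm (hlift d a b v - hlift d (x *: p) (x *: q) v) <=
    normc x * (m / 2) * hnorm v ^+ d.
  rewrite -hliftB; apply: le_trans (hlift_le _ _ _ _) _.
  by rewrite ler_wpM2r ?exprn_ge0 ?hnorm_ge0.
have up v : hnorm (hlift d a b v) <= normc x * (S + m / 2) * hnorm v ^+ d.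
  pose s := hlift d (x *: p) (x *: q) v.
  have := hnorm_add (hlift d a b v - s) s; rewrite subrK => h; apply: le_trans h _.
  rewrite addrC mulrDr mulrDl lerD // /s.
  by rewrite hliftZ hnormZ -mulrA ler_wpM2l // hlift_le.
have lo v : v != 0 -> normc x * (m / 2) * hnorm v ^+ d <= hnorm (hlift d a b v).
  move=> v0; have := hnorm_add (hlift d a b v) (hlift d (x *: p) (x *: q) v - hlift d a b v).
  rewrite addrC subrK [X in hnorm X <= _]hliftZ hnormZ.
  have -> (s t : C * C) : hnorm (s - t) = hnorm (t - s).
    by rewrite /hnorm /= -(normcN (s.1 - _)) -(normcN (s.2 - _)) !opprB.
  have := ler_wpM2l X0 (hm v v0); have := dv v; lra.
move=> u v u0 v0.
have m2 : 0 < m / 2 by rewrite divr_gt0.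
have P (w : C * C) : 0 <= hnorm w ^+ d by rewrite exprn_ge0 ?hnorm_ge0.
apply: le_trans (ler_wpM2r (P v) (up u)) _.
have k0 : 0 <= (S + m / 2) / (m / 2).
  exact: divr_ge0 (addr_ge0 S0 (ltW m2)) (ltW m2).
apply: le_trans (ler_wpM2l k0 (ler_wpM2r (P u) (lo v v0))).
by rewrite le_eqVlt; apply/orP; left; apply/eqP; field; rewrite gt_eqF.
Qed.

End Stability.

(** * Distortion of commuting maps *)

Section Commuting.
Variable R : realType.
Local Notation C := R[i].
Implicit Types (u v w : C * C) (x y z : C) (p q a b : {poly C}).

(** Let K be the supremum of [S].  Every s >= 1 in [S] satisfies
    s^2 <= s^N <= K A, hence K^2 <= K A, and K >= 1 can be cancelled. *)
Lemma ub_of_power_le (S : set R) (A c : R) (N : nat) : (2 <= N)%N -> 1 <= A ->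
  S 1 -> (forall s, S s -> s <= c) ->
  (forall k s, (forall t, S t -> t <= k) -> S s -> s ^+ N <= k * A) ->
  forall s, S s -> s <= A.
Proof.
move=> N2 A1 S1 Sc H s Ss.
have A0 : 0 < A by exact: lt_le_trans A1.
have hs : has_sup S by split; [exists 1|exists c].
have ub t : S t -> t <= sup S by move=> St; exact: (ub_le_sup hs.2).
have k1 : 1 <= sup S by exact: ub.
have k0 : 0 < sup S by exact: lt_le_trans k1.
apply: le_trans (ub _ Ss) _.
suff : sup S ^+ 2 <= sup S * A by rewrite expr2 ler_pM2l.
rewrite -[leRHS]sqr_sqrtr; last by rewrite mulr_ge0 // ltW.
rewrite ler_sqr ?nnegrE ?sqrtr_ge0 ?(ltW k0) //.
apply: ge_sup => [|t St]; first by exists 1.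
have [t1|t1] := leP t 1.
  apply: le_trans t1 _; rewrite -[leLHS]sqrtr1 ler_wsqrtr //.
  by rewrite -[leLHS]mulr1 ler_pM.
have t0 : 0 < t by exact: lt_trans t1.
rewrite -[t](ger0_norm (ltW t0)) -sqrtr_sqr ler_wsqrtr //.
apply: le_trans (H _ _ ub St); by rewrite ler_eXn2l.
Qed.

Lemma distortion_ge1 k (c : R) (F : C * C -> C * C) :
  (forall v, v != 0 -> F v != 0) -> distortion k c F -> 1 <= c.
Proof.
move=> F0 /(_ _ _ (e1_neq0 R) (e1_neq0 R)).
set t := _ * _; have t0 : 0 < t.
  by rewrite mulr_gt0 ?exprn_gt0 // hnorm_gt0 ?F0 // e1_neq0.
by rewrite -[X in X <= _]mul1r ler_pM2r.
Qed.

(** [ub_of_power_le] is applied to the set of the ratios r(u) / r(v), which the a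
    priori constant [c] bounds. *)
Lemma distortion_commute d N (c k : R) (F G : C * C -> C * C) : (2 <= N)%N ->
  (forall v, v != 0 -> F v != 0) -> (forall v, v != 0 -> G v != 0) ->
  (forall v, F (G v) = G (F v)) ->
  distortion d c F -> distortion N k G -> distortion d (k ^+ d.+1) F.
Proof.
move=> N2 F0 G0 FG dF dG.
have k1 := distortion_ge1 G0 dG.
pose r v := hnorm (F v) / hnorm v ^+ d.
pose rho v := hnorm (G v) / hnorm v ^+ N.
have np v : v != 0 -> 0 < hnorm v by exact: hnorm_gt0.
have npX v m : v != 0 -> 0 < hnorm v ^+ m by move=> v0; rewrite exprn_gt0 ?np.
have r0 v : v != 0 -> 0 < r v by move=> v0; rewrite divr_gt0 ?npX ?np ?F0.
have rho0 v : v != 0 -> 0 < rho v by move=> v0; rewrite divr_gt0 ?npX ?np ?G0.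
have drE (m : nat) (b : R) (H : C * C -> C * C) u v : u != 0 -> v != 0 ->
    (hnorm (H u) * hnorm v ^+ m <= b * (hnorm (H v) * hnorm u ^+ m)) =
    (hnorm (H u) / hnorm u ^+ m <= b * (hnorm (H v) / hnorm v ^+ m)).
  move=> u0 v0; rewrite ler_pdivrMr ?npX //.
  have -> : b * (hnorm (H v) / hnorm v ^+ m) * hnorm u ^+ m =
    b * (hnorm (H v) * hnorm u ^+ m) / hnorm v ^+ m by ring.
  by rewrite ler_pdivlMr ?npX.
have rhoE u v : u != 0 -> v != 0 -> rho u <= k * rho v.
  by move=> u0 v0; rewrite /rho -drE // dG.
(* the norm of F (G v) = G (F v), computed in two ways *)
have I v : v != 0 -> rho (F v) * r v ^+ N = r (G v) * rho v ^+ d.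
  move=> v0; rewrite /rho /r FG !expr_div_n -!exprM mulnC.
  have [h1 h2 h3] := And3 (npX _ N (F0 _ v0)) (npX _ d (G0 _ v0)) (npX _ (N * d)%N v0).
  by field; rewrite !gt_eqF.
move=> u v u0 v0; rewrite drE // -/(r u) -/(r v) -ler_pdivrMr ?r0 //.
pose S : set R := [set s | exists x y : C * C, [/\ x != 0, y != 0 & s = r x / r y]].
apply: (@ub_of_power_le S _ c N) => //; last by exists u, v.
- exact: exprn_ege1.
- by exists u, u; split=> //; rewrite divff // gt_eqF ?r0.
- move=> s [x [y [x0 y0 ->]]]; rewrite ler_pdivrMr ?r0 // /r -drE //; exact: dF.
move=> K s hK [x [y [x0 y0 ->]]].
have hr : r (G x) <= K * r (G y).
  by rewrite -ler_pdivrMr ?r0 ?G0 //; apply: hK; exists (G x), (G y); rewrite !G0.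
have K0 : 0 <= K by apply: le_trans ler01 _; apply: hK; exists u, u;
  split=> //; rewrite divff // gt_eqF ?r0.
have kp : 0 <= k by exact: le_trans k1.
have [FX FY] : 0 < rho (F x) /\ 0 < rho (F y) by rewrite !rho0 ?F0.
rewrite expr_div_n ler_pdivrMr ?exprn_gt0 ?r0 //.
rewrite -(ler_pM2l FX) I // -(ler_pM2l FY).
have -> : rho (F y) * (rho (F x) * (K * k ^+ d.+1 * r y ^+ N)) =
  (k * rho (F x)) * (K * k ^+ d * (rho (F y) * r y ^+ N)) by rewrite exprS; ring.
rewrite I //; apply: ler_pM; rewrite ?(ltW FY) ?rhoE ?F0 //.
  by rewrite mulr_ge0 ?exprn_ge0 // ltW ?r0 ?rho0 ?G0.
have -> : K * k ^+ d * (r (G y) * rho y ^+ d) = (K * r (G y)) * (k * rho y) ^+ d.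
  by rewrite (exprMn d k); ring.
have [rx0 ry0] := (ltW (rho0 _ x0), ltW (rho0 _ y0)).
apply: ler_pM => //; [exact: ltW (r0 _ (G0 _ x0))|exact: exprn_ge0|].
apply: lerXn2r; rewrite ?nnegrE //; [exact: mulr_ge0|exact: rhoE].
Qed.

End Commuting.

(** * Rational maps are Lipschitz *)

Section Maps.
Variable R : realType.
Local Notation C := R[i].
Local Notation P1 := (P1 R).
Implicit Types (u v w : C * C) (x y z : C) (p q a b : {poly C}).
Implicit Types (f g : {uniform P1 -> P1}).

Definition represents d p q f :=
  forall v : cvec R, f (\pi_P1 v) = toP1 (hlift d p q (val v)).

Lemma ratMapP d f :
  ratMap d f <-> exists p q, coprime_pair d p q /\ represents d p q f.
Proof.
split=> [[p [q [h1 h2 h3]]]|[p [q [[h1 h2] h3]]]]; exists p, q; split=> //.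
Qed.

Lemma normc_subrXX_le (M : R) x y k : normc x <= M -> normc y <= M ->
  normc (x ^+ k - y ^+ k) * M <= k%:R * normc (x - y) * M ^+ k.
Proof.
move=> xM yM; have M0 : 0 <= M by exact: le_trans (normc_ge0 x) xM.
case: k => [|k]; first by rewrite !expr0 subrr normc0 !mul0r.
rewrite subrXX normcM exprSr mulrA ler_wpM2r // [_%:R * _]mulrC -mulrA.
rewrite ler_wpM2l ?normc_ge0 //.
apply: le_trans (normc_sum _ _ _) _.
have -> : k.+1%:R * M ^+ k = \sum_(i < k.+1) M ^+ k.
  by rewrite sumr_const card_ord mulr_natl.
apply: ler_sum => i _; rewrite normcM !normcX /=.
have -> : M ^+ k = M ^+ (k - i) * M ^+ i by rewrite -exprD subnK // -ltnS.
by rewrite ler_pM ?exprn_ge0 ?normc_ge0 // lerXn2r ?nnegrE ?normc_ge0.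
Qed.

(** The basis of the forms of degree [d] underlying [hform]. *)
Definition monom2 d v i : C := v.1 ^+ i * v.2 ^+ (d - i).

(** The left-hand form is a common monomial times s^k - t^k with
    s = [u.2 * v.1], t = [u.1 * v.2] and k = [j - i]; it is divisible by
    s - t, which is the wedge of [u] and [v] up to sign.  The extra factor
    |u| |v| avoids the exponent [d - 1], and keeps [d = 0] from being special. *)
Lemma monom2_wedge_le d u v (i j : nat) : (i <= j <= d)%N ->
  normc (monom2 d u i * monom2 d v j - monom2 d u j * monom2 d v i) *
    (hnorm u * hnorm v) <=
  d%:R * normc (wedge u v) * (hnorm u * hnorm v) ^+ d.
Proof.
move=> /andP[ij jd]; set M := hnorm u * hnorm v.
have M0 : 0 <= M by rewrite mulr_ge0 ?hnorm_ge0.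
have dj : (d - i = (j - i) + (d - j))%N.
  by rewrite addnC addnBA // subnK.
have ji : (j = i + (j - i))%N by rewrite subnKC.
have dM : d = (i + (d - j) + (j - i))%N by rewrite -addnA [(d - j + _)%N]addnC -dj subnKC // (leq_trans ij).
pose s := u.2 * v.1; pose t := u.1 * v.2.
have le2 (a1 b1 : C) : normc a1 <= hnorm u -> normc b1 <= hnorm v ->
    normc (a1 * b1) <= M.
  by move=> h1 h2; rewrite normcM ler_pM ?normc_ge0.
have -> : monom2 d u i * monom2 d v j - monom2 d u j * monom2 d v i =
  (u.1 * v.1) ^+ i * (u.2 * v.2) ^+ (d - j) * (s ^+ (j - i) - t ^+ (j - i)).
  rewrite /monom2 dj !exprD; have E (x : C) : x ^+ j = x ^+ i * x ^+ (j - i).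
    by rewrite -exprD -ji.
  by rewrite !E !exprMn; ring.
rewrite normcM -mulrA.
have hc : normc ((u.1 * v.1) ^+ i * (u.2 * v.2) ^+ (d - j)) <= M ^+ i * M ^+ (d - j).
  rewrite normcM !normcX ler_pM ?exprn_ge0 ?normc_ge0 // lerXn2r ?nnegrE ?normc_ge0 //.
    by apply: le2; exact: normc_fst_le.
  by apply: le2; exact: normc_snd_le.
have hk : normc (s ^+ (j - i) - t ^+ (j - i)) * M <= d%:R * normc (wedge u v) * M ^+ (j - i).
  have hs : normc s <= M by rewrite le2 ?normc_fst_le ?normc_snd_le.
  have ht : normc t <= M by rewrite le2 ?normc_fst_le ?normc_snd_le.
  apply: le_trans (normc_subrXX_le _ hs ht) _.
  rewrite ler_wpM2r ?exprn_ge0 // -(normcN (s - t)) opprB.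
  by rewrite ler_wpM2r ?normc_ge0 // ler_nat (leq_trans (leq_subr _ _)).
have -> : d%:R * normc (wedge u v) * M ^+ d =
  M ^+ i * M ^+ (d - j) * (d%:R * normc (wedge u v) * M ^+ (j - i)).
  by rewrite {2}dM !exprD; ring.
by apply: ler_pM => //; [exact: normc_ge0|exact: mulr_ge0 (normc_ge0 _) M0].
Qed.

Lemma wedge_hlift_le d p q u v :
  normc (wedge (hlift d p q u) (hlift d p q v)) * (hnorm u * hnorm v) <=
  d%:R * coefsum d p * coefsum d q *
    (normc (wedge u v) * (hnorm u * hnorm v) ^+ d).
Proof.
have -> : wedge (hlift d p q u) (hlift d p q v) =
  \sum_(i < d.+1) \sum_(j < d.+1) p`_i * q`_j *
    (monom2 d u i * monom2 d v j - monom2 d u j * monom2 d v i).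
  rewrite /wedge /hlift /hform /= [X in _ - X]mulrC !big_distrlr /= -sumrB.
  apply: eq_bigr => i _; rewrite -sumrB; apply: eq_bigr => j _.
  by rewrite /monom2; ring.
have M0 : 0 <= hnorm u * hnorm v by rewrite mulr_ge0 ?hnorm_ge0.
have -> : d%:R * coefsum d p * coefsum d q *
    (normc (wedge u v) * (hnorm u * hnorm v) ^+ d) =
  \sum_(i < d.+1) \sum_(j < d.+1) normc p`_i * normc q`_j *
    (d%:R * normc (wedge u v) * (hnorm u * hnorm v) ^+ d).
  set E := d%:R * normc _ * _; set D := normc _ * _.
  have -> : d%:R * coefsum d p * coefsum d q * D = coefsum d p * coefsum d q * E.
    by rewrite /D /E; ring.
  rewrite /coefsum big_distrlr /= mulr_suml; apply: eq_bigr => i _.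
  by rewrite mulr_suml.
apply: le_trans (ler_wpM2r M0 (normc_sum _ _ _)) _.
rewrite mulr_suml; apply: ler_sum => i _.
apply: le_trans (ler_wpM2r M0 (normc_sum _ _ _)) _.
rewrite mulr_suml; apply: ler_sum => j _.
rewrite 2!normcM -(mulrA (_ * _)) ler_wpM2l ?mulr_ge0 ?normc_ge0 //.
have [ij|ji] := leqP i j; first by rewrite monom2_wedge_le // ij -ltnS ltn_ord.
by rewrite -normcN opprB monom2_wedge_le // (ltnW ji) -ltnS ltn_ord.
Qed.

(** Both chordal distances are quotients of a wedge by norms.  The wedges are
    compared by [wedge_hlift_le], the norms by [hlift_lower]. *)
Lemma ratMap_lipschitz d f : ratMap d f -> exists2 L : R, 0 <= L &
  forall x y : P1, distP1 (f x) (f y) <= L * distP1 x y.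
Proof.
move=> /ratMapP[p [q [cpq fE]]]; have [m m0 hm] := hlift_lower cpq.
exists (d%:R * coefsum d p * coefsum d q / m ^+ 2).
  by rewrite divr_ge0 ?sqr_ge0 // !mulr_ge0 ?coefsum_ge0.
move=> x y; have [u ->] := P1_rep x; have [v ->] := P1_rep y.
have [u0 v0] := (valP u, valP v).
rewrite !fE distP1_pi dist_toP1 ?hlift_neq0 // /chordal -/(wedge _ _).
move: (val u) (val v) u0 v0 => u' v' u0 v0.
have [nu nv] := (hnorm_gt0 u0, hnorm_gt0 v0).
have M0 : 0 < hnorm u' * hnorm v' by rewrite mulr_gt0.
have H := wedge_hlift_le d p q u' v'.
set K := d%:R * _ * _ in H *.
have K0 : 0 <= K by rewrite !mulr_ge0 ?coefsum_ge0.
have D : m ^+ 2 * (hnorm u' * hnorm v') ^+ d <=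
    hnorm (hlift d p q u') * hnorm (hlift d p q v').
  have -> : m ^+ 2 * (hnorm u' * hnorm v') ^+ d =
    (m * hnorm u' ^+ d) * (m * hnorm v' ^+ d) by rewrite exprMn; ring.
  by rewrite ler_pM ?hm // mulr_ge0 ?exprn_ge0 // ltW.
have D0 : 0 < m ^+ 2 * (hnorm u' * hnorm v') ^+ d by rewrite mulr_gt0 ?exprn_gt0.
rewrite ler_pdivrMr; last exact: lt_le_trans D.
have L0 : 0 <= K / m ^+ 2 * (normc (wedge u' v') / (hnorm u' * hnorm v')).
  apply: mulr_ge0; first by rewrite divr_ge0 ?sqr_ge0.
  by rewrite divr_ge0 ?normc_ge0 // ltW.
apply: le_trans (ler_wpM2l L0 D); rewrite -(ler_pM2r M0).
apply: le_trans H _; rewrite le_eqVlt; apply/orP; left; apply/eqP.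
by field; rewrite !gt_eqF.
Qed.

End Maps.

(** * Distortion of rational maps and of their iterates *)

Section Distortion.
Variable R : realType.
Local Notation C := R[i].
Local Notation P1 := (P1 R).
Implicit Types (u v w : C * C) (x y z : C) (p q a b : {poly C}).
Implicit Types (f g : {uniform P1 -> P1}).

Lemma representsE d p q f v (v0 : v != 0) : represents d p q f ->
  f (toP1 v) = toP1 (hlift d p q v).
Proof. by move=> fE; rewrite toP1E fE. Qed.

(** The polynomials of the iterated lift; they are needed explicitly, since
    [iter_ratMap] only provides some lift of the iterate. *)
Lemma iter_hlift n d p q : coprime_pair d p q -> exists a b,
  coprime_pair (d ^ n) a b /\
  forall v, hlift (d ^ n) a b v = iter n (hlift d p q) v.
Proof.
move=> cpq; have [sp sq nz] := (coprime_hformP d p q).1 cpq.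
elim: n => [|n [a [b [cab E]]]].
  exists 'X, 1; split.
    by split; [exact: coprimep1|rewrite size_polyX size_poly1].
  case=> z w; rewrite /hlift /hform !big_ord_recl !big_ord0 /= !coefX !coef1 /=.
  by rewrite !(mul0r, mul1r, add0r, addr0, expr0, expr1, mulr1).
have [sa sb nzab] := (coprime_hformP _ a b).1 cab.
exists (subst_form d p a b), (subst_form d q a b).
have S r v := @subst_formP R d (d ^ n) r a b v sa sb.
have H v : hlift (d ^ n.+1) (subst_form d p a b) (subst_form d q a b) v =
    hlift d p q (hlift (d ^ n) a b v).
  by rewrite /hlift expnS !(S _ _).2.
split; last by move=> v; rewrite H E.
apply/coprime_hformP; rewrite {1 2}expnS.
split; [exact: (S p 0).1|exact: (S q 0).1|] => v v0.
have := H v; rewrite /hlift => ->; exact: nz _ (nzab v v0).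
Qed.

Lemma represents_iter n d p q f : coprime_pair d p q -> represents d p q f ->
  forall v : cvec R, iter n f (\pi_P1 v) = toP1 (iter n (hlift d p q) (val v)).
Proof.
move=> cpq fE v; suff [H _] : iter n f (\pi_P1 v) = toP1 (iter n (hlift d p q) (val v))
   /\ iter n (hlift d p q) (val v) != 0 by [].
elim: n => [|n [IH n0]] /=.
  by split; [rewrite (toP1E (valP v)); congr \pi; exact: val_inj|exact: (valP v)].
by rewrite IH (representsE n0 fE) hlift_neq0.
Qed.

(** Lifts of the same map have a zero wedge everywhere, so they are proportional
    by [proportional_pairs]. *)
Lemma represents_unique d p q a b f : coprime_pair d p q -> coprime_pair d a b ->
  represents d p q f -> represents d a b f ->
  exists2 x, x != 0 & forall v, hlift d a b v = (x * (hlift d p q v).1, x * (hlift d p q v).2).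
Proof.
move=> cpq cab hpq hab.
have [sp sq _] := (coprime_hformP _ p q).1 cpq.
have [sa sb _] := (coprime_hformP _ a b).1 cab.
have W0 v : v != 0 -> wedge (hlift d p q v) (hlift d a b v) = 0.
  move=> v0; have [n1 n2] := (hlift_neq0 cpq v0, hlift_neq0 cab v0).
  have := dist_toP1 n1 n2; rewrite -(representsE v0 hpq) -(representsE v0 hab).
  rewrite distP1xx => /esym/eqP; rewrite mulf_eq0 invr_eq0 normc_eq0.
  by rewrite (gt_eqF (mulr_gt0 (hnorm_gt0 n1) (hnorm_gt0 n2))) orbF => /eqP.
have [x [ax bx]] : exists x, a = x *: p /\ b = x *: q.
  apply: (proportional_pairs cpq sa sb); apply: (@poly_zero_nat _ (d + d).+1).
    exact: size_wedge_poly sp sq sa sb.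
  move=> j _; rewrite -(@wedge_hliftE _ d) // W0 //.
  by apply/eqP => -[_ /eqP]; rewrite oner_eq0.
exists x; last by move=> v; rewrite ax bx hliftZ.
apply: contraTneq (hlift_neq0 cab (e1_neq0 R)) => x0.
by rewrite ax bx hliftZ x0 !mul0r negbK.
Qed.

Lemma distortionZ d (c : R) x (F G : C * C -> C * C) : x != 0 ->
  (forall v, G v = (x * (F v).1, x * (F v).2)) ->
  distortion d c G <-> distortion d c F.
Proof.
move=> x0 GF; have X0 : 0 < normc x by rewrite normc_gt0.
have E u v k : (hnorm (G u) * hnorm v ^+ k <= c * (hnorm (G v) * hnorm u ^+ k)) =
    (hnorm (F u) * hnorm v ^+ k <= c * (hnorm (F v) * hnorm u ^+ k)).
  by rewrite !GF !hnormZ -!mulrA [leRHS]mulrCA ler_pM2l.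
by split=> H u v u0 v0; [rewrite -E|rewrite E]; exact: H.
Qed.

(** By [represents_unique] and [distortionZ], all coprime lifts of [f] have the
    same distortion, so it does not matter which one is taken. *)
Definition distorted d (c : R) f := exists p q,
  [/\ coprime_pair d p q, represents d p q f & distortion d c (hlift d p q)].

(** The lift [F] commutes with its iterate, which is proportional to any other
    lift of the iterated map, so [distortion_commute] applies. *)
Lemma distorted_iter n d (c : R) f : (1 <= n)%N -> (2 <= d)%N -> ratMap d f ->
  distorted (d ^ n) c (iter n f) -> distorted d (c ^+ d.+1) f.
Proof.
move=> n1 d2 /ratMapP[p [q [cpq fE]]] [a [b [cab gE dab]]].
exists p, q; split=> //.
have [a' [b' [cab' E]]] := iter_hlift n cpq.
have gE' : represents (d ^ n) a' b' (iter n f).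
  by move=> v; rewrite (represents_iter n cpq fE) E.
have [x x0 H] := represents_unique cab' cab gE' gE.
have {}dab : distortion (d ^ n) c (hlift (d ^ n) a' b') by apply/(distortionZ _ _ x0 H).
have [m m0 hm] := hlift_lower cpq.
pose S := coefsum d p + coefsum d q.
have S0 : 0 <= S by rewrite addr_ge0 ?coefsum_ge0.
apply: (@distortion_commute _ d (d ^ n) (S / m)) dab.
- by apply: (leq_trans d2); rewrite -{1}(expn1 d) leq_exp2l.
- by move=> v; exact: hlift_neq0.
- by move=> v; exact: hlift_neq0.
- by move=> v; rewrite !E -iterS -iterSr.
move=> u v u0 v0; have := hlift_le d p q u; rewrite -/S => hu.
have P w : 0 <= hnorm w ^+ d by rewrite exprn_ge0 ?hnorm_ge0.
apply: le_trans (ler_wpM2r (P v) hu) _.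
rewrite -!mulrA ler_wpM2l // ler_pdivlMl //.
have := ler_wpM2r (P u) (hm v v0); lra.
Qed.

Lemma distorted_near d f : ratMap d f -> exists e c : R, 0 < e /\
  forall g, ratMap d g -> (forall s, distP1 (f s) (g s) <= e) -> distorted d c g.
Proof.
move=> /ratMapP[p [q [cpq fE]]]; have [e [c [e0 H]]] := distortion_near cpq.
exists e, c; split=> // g /ratMapP[a [b [cab gE]]] fg.
exists a, b; split=> //.
have [sa sb _] := (coprime_hformP _ a b).1 cab.
apply: H => // v v0; have := fg (toP1 v).
rewrite (representsE v0 fE) (representsE v0 gE) dist_toP1 ?hlift_neq0 //.
by rewrite ler_pdivrMr // mulr_gt0 ?hnorm_gt0 ?hlift_neq0.
Qed.

(** Divide a lift by its norm at [(1, 0)]: then all its values on the unit sphere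
    have norm between [c^-1] and [c], and interpolation bounds its coefficients
    by a constant [B] that does not depend on [f]. *)
Lemma distorted_normalized d (c : R) : exists B : R, forall f, distorted d c f ->
  exists p q, [/\ represents d p q f, coprime_pair d p q,
    coefsum d p + coefsum d q <= B &
    forall v, v != 0 -> c^-1 * hnorm v ^+ d <= hnorm (hlift d p q v)].
Proof.
have [K K0 HK] := coefsum_le_values R d.
pose D : R := \sum_(j < d.+1) c * hnorm (j%:R, 1 : C) ^+ d.
exists (K * D + K * D) => f [p [q [cpq fE dpq]]].
have c1 : 1 <= c by apply: distortion_ge1 (dpq) => v; exact: hlift_neq0.
have c0 : 0 < c by exact: lt_le_trans c1.
have D0 : 0 <= D by apply: sumr_ge0 => j _; rewrite mulr_ge0 ?exprn_ge0 ?hnorm_ge0 // ltW.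
pose t := hnorm (hlift d p q (1, 0)).
have t0 : 0 < t by rewrite hnorm_gt0 ?hlift_neq0 ?e1_neq0.
pose x : C := (t^-1)%:C%C.
have nx : normc x = t^-1 by rewrite /= expr0n addr0 sqrtr_sqr ger0_norm // invr_ge0 ltW.
have x0 : x != 0 by rewrite -normc_gt0 nx invr_gt0.
have E v : hnorm (hlift d (x *: p) (x *: q) v) = t^-1 * hnorm (hlift d p q v).
  by rewrite hliftZ hnormZ nx.
have h1 : hnorm ((1, 0) : C * C) = 1.
  by rewrite /hnorm (@normc1 R) (@normc0 R) expr0n addr0 expr1n sqrtr1.
have up v : v != 0 -> hnorm (hlift d (x *: p) (x *: q) v) <= c * hnorm v ^+ d.
  move=> v0; have := dpq v (1, 0) v0 (e1_neq0 R).
  by rewrite h1 expr1n mulr1 -/t mulrCA E ler_pdivrMl.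
have lo v : v != 0 -> c^-1 * hnorm v ^+ d <= hnorm (hlift d (x *: p) (x *: q) v).
  move=> v0; have := dpq (1, 0) v (e1_neq0 R) v0.
  rewrite h1 expr1n mulr1 -/t E => h.
  by rewrite ler_pdivrMl // mulrCA ler_pdivlMl.
have [sp sq nz] := (coprime_hformP _ p q).1 cpq.
have sx (r : {poly C}) : (size r <= d.+1)%N -> (size (x *: r) <= d.+1)%N.
  exact: leq_trans (size_scale_leq _ _).
exists (x *: p), (x *: q); split=> //.
- move=> v; rewrite fE hliftZ toP1Z //; apply: hlift_neq0 => //; exact: valP v.
- apply/coprime_hformP; split; [exact: sx|exact: sx|] => v v0.
  have := lo v v0; rewrite -[(_, _)]/(hlift d (x *: p) (x *: q) v) => h.
  apply: contraTneq h => ->; rewrite -ltNge /hnorm (@normc0 R) expr0n addr0 sqrtr0.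
  by rewrite mulr_gt0 ?invr_gt0 ?exprn_gt0 ?hnorm_gt0.
have j0 (j : nat) : (j%:R, 1) != 0 :> C * C.
  by apply/eqP => -[_ /eqP]; rewrite oner_eq0.
have vj (j : nat) : (j < d.+1)%N -> hnorm (hlift d (x *: p) (x *: q) (j%:R, 1)) <= D.
  move=> jd; apply: le_trans (up _ (j0 j)) _.
  rewrite /D (bigD1 (Ordinal jd)) //= lerDl; apply: sumr_ge0 => i _.
  by rewrite mulr_ge0 ?exprn_ge0 ?hnorm_ge0 // ltW.
have ev (r : {poly C}) (j : nat) : (size r <= d.+1)%N -> hform d r (j%:R, 1) = r.[j%:R].
  by move=> sr; rewrite hform_fin ?oner_eq0 // expr1n mul1r divr1.
apply: lerD; apply: HK; rewrite ?sx // => j jd; rewrite -ev ?sx //;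
  apply: le_trans (vj j jd); [exact: (normc_fst_le (hlift d _ _ _))|exact: (normc_snd_le (hlift d _ _ _))].
Qed.

End Distortion.

(** * The topology of the spaces of rational maps *)

Section Topology.
Variable R : realType.
Local Notation C := R[i].
Local Notation P1 := (P1 R).
Implicit Types (u v w : C * C) (p q a b : {poly C}).
Implicit Types (f g : {uniform P1 -> P1}).

Lemma nbhs_uniformP f (A : set {uniform P1 -> P1}) : nbhs f A <->
  exists2 e : R, 0 < e & forall g, (forall s, distP1 (f s) (g s) < e) -> A g.
Proof.
split=> [/uniform_nbhs[E [entE EA]]|[e e0 eA]].
  move: entE; rewrite -entourage_ballE => -[e /= e0 eE].
  exists e => // g fg; apply: EA => s _; apply: eE => /=.
  by rewrite ballEmdist /=; exact: fg.
apply/uniform_nbhs; exists [set xy | ball xy.1 e xy.2]; split.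
  by rewrite -entourage_ballE; exists e.
move=> g fg; apply: eA => s; have := fg s I.
by rewrite /= ballEmdist.
Qed.

Lemma nbhs_ratMapP d (f : ratMap d) (A : set (ratMap (R := R) d)) : nbhs f A <->
  exists2 e : R, 0 < e &
    forall g : ratMap d, (forall s, distP1 (val f s) (val g s) < e) -> A g.
Proof.
split=> [[_ [[W oW <-] Wf sWA]]|[e e0 eA]].
  have /nbhs_uniformP[e e0 eW] : nbhs (set_val f) W by exact: open_nbhs_nbhs.
  by exists e => // g fg; apply: sWA; apply: eW.
have H : nbhs (set_val f : {uniform P1 -> P1})
    [set g | forall s, distP1 (val f s) (g s) < e].
  by apply/nbhs_uniformP; exists e.
have {}H : nbhs f (set_val @^-1` [set g | forall s, distP1 (val f s) (g s) < e]).
  exact: initial_continuous H.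
by apply: filterS H => g; exact: eA.
Qed.

Lemma ratMap_hausdorff d : hausdorff_space (ratMap (R := R) d).
Proof.
move=> f g fg; apply: val_inj; apply/funext => s.
apply: contrapT => /eqP fs.
have D0 : 0 < distP1 (val f s) (val g s).
  rewrite lt_neqAle; apply/andP; split.
    by rewrite eq_sym; apply: contra fs => /eqP /distP1_eq0 ->.
  by rewrite divr_ge0 ?normc_ge0 // mulr_ge0 ?hnorm_ge0.
set D := distP1 _ _ in D0.
have nb (h : ratMap (R := R) d) : nbhs h
    [set k : ratMap (R := R) d | distP1 (val h s) (val k s) < D / 2].
  by apply/nbhs_ratMapP; exists (D / 2) => [|k]; [rewrite divr_gt0|exact].
have [k [/= fk gk]] := fg _ _ (nb f) (nb g).
have := distP1_triangle (val k s) (val f s) (val g s).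
rewrite -/D (distP1_sym (val k s)); lra.
Qed.

Lemma iter_near n d f : ratMap d f -> forall e : R, 0 < e ->
  exists2 e' : R, 0 < e' & forall g, (forall s, distP1 (f s) (g s) < e') ->
    forall s, distP1 (iter n f s) (iter n g s) < e.
Proof.
move=> /ratMap_lipschitz[L L0 fL]; elim: n => [|n IH] e e0.
  by exists 1 => // g _ s /=; rewrite distP1xx.
have L1 : 0 < L + 1 by rewrite ltr_wpDl.
have [|e' e'0 He'] := IH (e / 2 / (L + 1)); first by rewrite !divr_gt0.
exists (Num.min e' (e / 2)); first by rewrite lt_min e'0 divr_gt0.
move=> g fg s.
have h1 : distP1 (iter n f s) (iter n g s) < e / 2 / (L + 1).
  by apply: He' => t; have := fg t; rewrite lt_min => /andP[].
have h2 : distP1 (f (iter n g s)) (g (iter n g s)) < e / 2.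
  by have := fg (iter n g s); rewrite lt_min => /andP[].
have h3 := fL (iter n f s) (iter n g s).
have := distP1_triangle (f (iter n g s)) (iter n.+1 f s) (iter n.+1 g s).
have h4 : L * distP1 (iter n f s) (iter n g s) <= e / 2.
  apply: le_trans (_ : (L + 1) * (e / 2 / (L + 1)) <= _); last first.
    by rewrite mulrC divfK // gt_eqF.
  apply: ler_pM => //; [|by rewrite lerDl|exact: ltW].
  by rewrite divr_ge0 ?normc_ge0 // mulr_ge0 ?hnorm_ge0.
rewrite !iterS; lra.
Qed.

Lemma iterate_map_continuous n d : continuous (@iterate_map R n d).
Proof.
move=> f A /nbhs_ratMapP[e e0 eA].
have [e' e'0 He'] := iter_near n (set_valP f) e0.
by apply/nbhs_ratMapP; exists e' => // g fg; apply: eA; exact: He'.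
Qed.

(** Compactness of a box in C^m, seen as R^2m, phrased without naming the cluster
    filter so that it can be applied to choices of lifts. *)
Lemma bounded_cluster (T : Type) (F : set_system T) m (s : T -> 'rV[C]_m) (B : R)
    (E0 : set T) : ProperFilter F -> F E0 ->
  (forall t, E0 t -> forall i, normc (s t 0 i) <= B) ->
  exists x : 'rV[C]_m, forall e : R, 0 < e -> forall E, F E ->
    exists2 t, E t & forall i, normc ((s t - x) 0 i) <= e.
Proof.
move=> PF FE0 sB.
pose z t : 'rV[R]_(m + m) := row_mx (map_mx (@complex.Re R) (s t)) (map_mx (@complex.Im R) (s t)).
have le_normc (y : C) : `|complex.Re y| <= normc y /\ `|complex.Im y| <= normc y.
  by split; rewrite -ler_sqr ?nnegrE ?normc_ge0 // normc2E real_normK ?num_real //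
    ?lerDl ?lerDr sqr_ge0.
have box : compact [set y : 'rV[R]_(m + m) | forall i, (`[- B, B]%classic : set R) (y ord0 i)].
  by apply: (@rV_compact R _ (fun=> `[- B, B]%classic)) => i; exact: segment_compact.
have zbox t : E0 t -> forall i, (`[- B, B]%classic : set R) (z t ord0 i).
  move=> Et i; rewrite /= in_itv /= -ler_norml /z.
  have [j ->|j ->] := split_ordP i; rewrite ?row_mxEl ?row_mxEr mxE.
    exact: le_trans (le_normc _).1 (sB _ Et _).
  exact: le_trans (le_normc _).2 (sB _ Et _).
have FB : F (z @^-1` [set y | forall i, (`[- B, B]%classic : set R) (y ord0 i)]).
  by apply: filterS FE0 => t Et; exact: zbox.
have [y [_ cy]] := box _ (fmap_proper_filter z PF) FB.
exists (\row_i (y 0 (lshift m i) +i* y 0 (rshift m i))%C) => e e0 E FE.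
have e2 : 0 < e / 2 by rewrite divr_gt0.
have [_ [[t Et <-] yt]] := cy (z @` E) (ball y (e / 2))
  (filterS (fun t Et => ex_intro2 _ _ t Et erefl) FE) (nbhsx_ballx _ _ e2).
exists t => // i.
have normc_le (x : C) : normc x <= `|complex.Re x| + `|complex.Im x|.
  rewrite -ler_sqr ?nnegrE ?normc_ge0 ?addr_ge0 // normc2E sqrrD !real_normK ?num_real //.
  by rewrite -addrA [_ *+ 2 + _]addrC addrA lerDl mulrn_wge0 // mulr_ge0.
apply: le_trans (normc_le _) _.
have := yt.2 0 (lshift m i); have := yt.2 0 (rshift m i).
rewrite /z row_mxEl row_mxEr !mxE /ball /=.
case: (s t 0 i) => c1 c2 /=.
rewrite (distrC _ c1) (distrC _ c2); lra.
Qed.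

Lemma distorted_le d (c c' : R) f : c <= c' -> distorted d c f -> distorted d c' f.
Proof.
move=> cc' [p [q [cpq fE dpq]]]; exists p, q; split=> // u v u0 v0.
apply: le_trans (dpq u v u0 v0) _.
by rewrite ler_wpM2r // mulr_ge0 ?exprn_ge0 ?hnorm_ge0.
Qed.

(** Near each map the distortion is bounded by some constant; letting the bound
    tend to infinity, near-covering compactness makes it uniform. *)
Lemma compact_distorted d (K : set (ratMap (R := R) d)) : compact K ->
  exists c : R, forall f : ratMap d, K f -> distorted d c (val f).
Proof.
move=> /compact_near_coveringP cK.
have [f Kf|c Hc] := filter_ex
    (cK R +oo%R (fun c (f : ratMap d) => distorted d c (val f)) _ _); last by exists c.
have [e [c [e0 Hc]]] := distorted_near (set_valP f).
exists ([set g : ratMap (R := R) d | forall s, distP1 (val f s) (val g s) < e],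
  [set c' : R | c <= c']).
  split; last by apply: nbhs_pinfty_ge; exact: num_real.
  by apply/nbhs_ratMapP; exists e.
move=> [g c'] [/= fg cc']; apply: distorted_le cc' _.
by apply: (Hc _ (set_valP g)) => s; exact: ltW (fg s).
Qed.

Lemma bounded_lifts_cluster (T : Type) (F : set_system T) d (s : T -> {poly C} * {poly C})
    (B : R) (E0 : set T) : ProperFilter F -> F E0 ->
  (forall t, E0 t -> [/\ (size (s t).1 <= d.+1)%N, (size (s t).2 <= d.+1)%N &
     coefsum d (s t).1 + coefsum d (s t).2 <= B]) ->
  exists a b, [/\ (size a <= d.+1)%N, (size b <= d.+1)%N &
    forall e : R, 0 < e -> forall E, F E -> exists2 t, E t & forall v,
      hnorm (hlift d (s t).1 (s t).2 v - hlift d a b v) <= e * hnorm v ^+ d].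
Proof.
move=> PF FE0 sB.
pose z t : 'rV[C]_(d.+1 + d.+1) := row_mx (poly_rV (s t).1) (poly_rV (s t).2).
have coef_le p (i : 'I_d.+1) : normc p`_i <= coefsum d p.
  rewrite /coefsum (bigD1 i) //= lerDl; apply: sumr_ge0 => j _; exact: normc_ge0.
have [|x cx] := @bounded_cluster T F _ z B E0 PF FE0.
  move=> t /sB[_ _ tB] i; rewrite /z.
  apply: le_trans tB.
  have [j ->|j ->] := split_ordP i; rewrite ?row_mxEl ?row_mxEr mxE.
    by apply: le_trans (coef_le _ _) _; rewrite lerDl coefsum_ge0.
  by apply: le_trans (coef_le _ _) _; rewrite lerDr coefsum_ge0.
exists (rVpoly (lsubmx x)), (rVpoly (rsubmx x)); split; try exact: size_poly.
move=> e e0 E FE.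
have [|t [Et E0t] tx] := cx (e / (d.+1%:R + d.+1%:R)) _ _ (filterI FE FE0).
  by rewrite divr_gt0 // addr_gt0.
exists t => // v; rewrite -hliftB; apply: le_trans (hlift_le _ _ _ _) _.
rewrite ler_wpM2r ?exprn_ge0 ?hnorm_ge0 //.
set e' := e / _ in tx.
have -> : e = \sum_(i < d.+1) e' + \sum_(i < d.+1) e'.
  by rewrite !sumr_const card_ord -mulrnDr -mulr_natr natrD /e' divfK.
apply: lerD; apply: ler_sum => i _; rewrite coefB coef_rVpoly_ord.
  by have := tx (lshift _ i); rewrite /z mxE row_mxEl !mxE.
by have := tx (rshift _ i); rewrite /z mxE row_mxEr !mxE.
Qed.

(** Choose normalized lifts along the filter and take a cluster point of their
    coefficients.  The lower bounds survive up to a factor 2, so the cluster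
    point is a lift of a rational map of degree exactly [d], and closeness of
    coefficients then gives uniform closeness of the maps. *)
Lemma distorted_cluster d (c : R) (F : set_system (ratMap (R := R) d)) :
  ProperFilter F -> F [set f : ratMap (R := R) d | distorted d c (val f)] -> cluster F !=set0.
Proof.
move=> PF Fc; have [B HB] := distorted_normalized d c.
pose good (f : ratMap (R := R) d) (pq : {poly C} * {poly C}) :=
  [/\ represents d pq.1 pq.2 (val f), coprime_pair d pq.1 pq.2,
    coefsum d pq.1 + coefsum d pq.2 <= B &
    forall v, v != 0 -> c^-1 * hnorm v ^+ d <= hnorm (hlift d pq.1 pq.2 v)].
have /choice[s hs] : forall f : ratMap (R := R) d, exists pq, distorted d c (val f) -> good f pq.
  move=> f; have [/HB[p [q h]]|nd] := pselect (distorted d c (val f)).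
    by exists (p, q).
  by exists (0, 0).
have [f0 df0] := filter_ex Fc.
have c0 : 0 < c.
  have [p [q [cpq _ dpq]]] := df0; apply: (@lt_le_trans _ _ 1) => //.
  by apply: distortion_ge1 (dpq) => v; exact: hlift_neq0.
have ci0 : 0 < c^-1 by rewrite invr_gt0.
have [|a [b [sa sb near]]] := bounded_lifts_cluster (s := s) (d := d) (B := B) PF Fc.
  move=> t /hs[_ cpq tB _]; have [sp sq _] := (coprime_hformP d _ _).1 cpq.
  by split.
have lo v : v != 0 -> c^-1 / 2 * hnorm v ^+ d <= hnorm (hlift d a b v).
  move=> v0; have [t dt /(_ v) h] := near (c^-1 / 2) (divr_gt0 ci0 (ltr0Sn _ _)) _ Fc.
  have [_ _ _ /(_ v v0)] := hs _ dt.
  have := hnorm_add (hlift d (s t).1 (s t).2 v - hlift d a b v) (hlift d a b v).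
  rewrite subrK; lra.
have cab : coprime_pair d a b.
  apply/coprime_hformP; split=> // v v0; rewrite -/(hlift d a b v).
  apply: contraTneq (lo v v0) => ->.
  rewrite -ltNge /hnorm (@normc0 R) expr0n addr0 sqrtr0.
  by rewrite mulr_gt0 ?divr_gt0 ?exprn_gt0 ?hnorm_gt0.
pose g : {uniform P1 -> P1} := fun x => toP1 (hlift d a b (val (repr x))).
have gE : represents d a b g.
  move=> v; have /eqmodP/asboolP[y y0 E] : v = repr (\pi_P1 v) %[mod P1] by rewrite reprK.
  have v0 := valP v; have y0' : y ^+ d != 0 by rewrite expf_neq0.
  by rewrite /g E hlift_homog toP1Z // hlift_neq0.
have rg : ratMap d g by apply/ratMapP; exists a, b.
pose G : ratMap (R := R) d := SigSub (mem_set rg).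
exists G => E U FE /nbhs_ratMapP[e e0 eU].
have [|t [Et dt] tE] := near (c^-1 * e / 2) _ _ (filterI FE Fc).
  by rewrite !divr_gt0 // mulr_gt0.
have [tp ct _ tlo] := hs _ dt.
exists t; split=> //; apply: eU => x; have [v ->] := P1_rep x.
have v0 := valP v; rewrite tp (_ : val G = g) // gE dist_toP1 ?hlift_neq0 //.
have -> : wedge (hlift d a b (val v)) (hlift d (s t).1 (s t).2 (val v)) =
   wedge (hlift d a b (val v)) (hlift d (s t).1 (s t).2 (val v) - hlift d a b (val v)).
  by rewrite wedgeB wedgexx subr0.
have n1 := hnorm_gt0 (hlift_neq0 cab v0); have n2 := hnorm_gt0 (hlift_neq0 ct v0).
rewrite ltr_pdivrMr ?mulr_gt0 //; apply: le_lt_trans (wedge_le _ _) _.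
rewrite mulrCA ltr_pM2l //; apply: le_lt_trans (tE _) _.
apply: lt_le_trans (_ : e * (c^-1 * hnorm (val v) ^+ d) <= _); last first.
  by rewrite ler_wpM2l ?tlo // ltW.
have -> : c^-1 * e / 2 * hnorm (val v) ^+ d = e * (c^-1 * hnorm (val v) ^+ d) / 2 by ring.
have P : 0 < e * (c^-1 * hnorm (val v) ^+ d) by rewrite !mulr_gt0 // exprn_gt0 // hnorm_gt0.
lra.
Qed.

End Topology.

Theorem corollary3 (R : realType) (n d : nat) (hn : (1 <= n)%N) (hd : (2 <= d)%N) :
  proper_map (@iterate_map R n d).
Proof.
split; first exact: iterate_map_continuous.
move=> K cK; have [c Kc] := compact_distorted cK.
move=> F PF FK; have [|f clf] := @distorted_cluster R d (c ^+ d.+1) F PF.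
  apply: filterS FK => f /Kc; exact: distorted_iter (set_valP f).
exists f; split=> //.
apply: (compact_closed (@ratMap_hausdorff R _) cK) => B nB.
have [g [Kg Bg]] := clf _ _ FK (iterate_map_continuous nB).
by exists (iterate_map n g).
Qed.
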